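(* There is an algorithm which, given the arena $\mathcal{D}$ of a $p$-periodic graph on an $n$-vertex set $V$ (given explicitly, with $m=|E(\mathcal{D})|=\sum_{i=0}^{p-1}|E_i|$ edges), decides whether $\mathcal{D}$ is copwin in time $O(p\,n^2+n\,m)$.
   Context: Let $V$ be a finite set of $n$ vertices and $p\ge 1$ an integer; $[t]_p$ denotes $t \bmod p$. A $p$-periodic graph $\mathcal{G}=(G_0,\dots,G_{p-1})^*$ is the infinite sequence of directed graphs $G_t=(V,E_{[t]_p})$ where $E_0,\dots,E_{p-1}\subseteq V\times V$ (self-loops allowed), each $G_i$ sinkless (every vertex has an out-edge). Its arena $\mathcal{D}$ is the directed graph on $\mathbb{Z}_p\times V$ with $((i,u),([i+1]_p,v))\in E(\mathcal{D})$ iff $(u,v)\in E_i$; write $\Gamma_t(u,\mathcal{D})=\{v:((t,u),([t+1]_p,v))\in E(\mathcal{D})\}$. Game: first the cop, then the robber choose vertices. In each round $t=0,1,\dots$, with cop at $c$ and robber at $r$, the cop must move to some $c'\in\Gamma_{[t]_p}(c,\mathcal{D})$; if $c'=r$ the cop wins and the game ends; otherwise the robber must move to some $r'\in\Gamma_{[t]_p}(r,\mathcal{D})$ and the next round starts. $\mathcal{D}$ is copwin if there is a starting vertex $c$ for the cop and a cop strategy that, for every starting vertex and strategy of the robber, captures the robber in finitely many rounds. *)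

(* Defs.v *)
From mathcomp Require Import all_boot.
Set Implicit Arguments. Unset Strict Implicit. Unset Printing Implicit Defensive.

(* V = 'I_n ; E i is the edge relation E_i of G_i, used for i < p only *)
(* (the game only ever reads E at indices t %% p).                      *)

Definition sinkless (p n : nat) (E : nat -> rel 'I_n) : Prop :=
  forall i, i < p -> forall u : 'I_n, exists v : 'I_n, E i u v.

Definition Gamma (p n : nat) (E : nat -> rel 'I_n) (t : nat) (u v : 'I_n) : bool :=
  E (t %% p) u v.

(* A history is the nonempty list of positions (cop, robber) at the start of
   rounds 0, 1, ..., t; the current round is (size h).-1. *)
Definition history (n : nat) := seq ('I_n * 'I_n).
Definition cop_strategy (n : nat) := history n -> 'I_n.
Definition robber_strategy (n : nat) := history n -> 'I_n -> 'I_n.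

Definition legal_cop (p n : nat) (E : nat -> rel 'I_n) (s : cop_strategy n) : Prop :=
  forall (h : history n) (c r : 'I_n), Gamma p E (size h) c (s (rcons h (c, r))).

Definition legal_robber (p n : nat) (E : nat -> rel 'I_n) (s : robber_strategy n) : Prop :=
  forall (h : history n) (c r c' : 'I_n), Gamma p E (size h) r (s (rcons h (c, r)) c').

Fixpoint play (n : nat) (c0 r0 : 'I_n) (sc : cop_strategy n) (sr : robber_strategy n)
  (t : nat) : history n :=
  match t with
  | 0 => [:: (c0, r0)]
  | t'.+1 => let h := play c0 r0 sc sr t' in
             let c' := sc h in rcons h (c', sr h c')
  end.

Definition captured_at (n : nat) (c0 r0 : 'I_n) (sc : cop_strategy n)
  (sr : robber_strategy n) (t : nat) : Prop :=
  let h := play c0 r0 sc sr t in sc h = (last (c0, r0) h).2.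

Definition copwin (p n : nat) (E : nat -> rel 'I_n) : Prop :=
  exists (c0 : 'I_n) (sc : cop_strategy n),
    legal_cop p E sc /\
    forall (r0 : 'I_n) (sr : robber_strategy n),
      legal_robber p E sr -> exists t, captured_at c0 r0 sc sr t.

(* Registers reg (directly addressed) and memory mem (indirectly        *)
(* addressed), all holding naturals below the word bound W; an          *)
(* instruction producing a value >= W makes the machine crash.          *)
Inductive instr : Type :=
| IConst of nat & nat
| IAdd of nat & nat & nat
| ISub of nat & nat & nat      (* reg r := reg s - reg t (truncated) *)
| IMul of nat & nat & nat
| IDiv of nat & nat & nat      (* reg r := reg s %/ reg t (x %/ 0 = 0) *)
| ILoad of nat & nat
| IStore of nat & nat
| IJz of nat & nat
| IJmp of nat
| IHalt.

Record config := Config { pc : nat; reg : nat -> nat; mem : nat -> nat }.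

Definition upd (f : nat -> nat) (a v : nat) : nat -> nat :=
  fun x => if x == a then v else f x.

Definition setreg (W : nat) (c : config) (r v : nat) : option config :=
  if v < W then Some (Config (pc c).+1 (upd (reg c) r v) (mem c)) else None.

Definition step (W : nat) (prog : seq instr) (c : config) : option config :=
  match nth IHalt prog (pc c) with
  | IConst r k => setreg W c r k
  | IAdd r s t => setreg W c r (reg c s + reg c t)
  | ISub r s t => setreg W c r (reg c s - reg c t)
  | IMul r s t => setreg W c r (reg c s * reg c t)
  | IDiv r s t => setreg W c r (reg c s %/ reg c t)
  | ILoad r s => setreg W c r (mem c (reg c s))
  | IStore r s => Some (Config (pc c).+1 (reg c) (upd (mem c) (reg c r) (reg c s)))
  | IJz r l => Some (Config (if reg c r == 0 then l else (pc c).+1) (reg c) (mem c))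
  | IJmp l => Some (Config l (reg c) (mem c))
  | IHalt => None
  end.

Fixpoint run (W : nat) (prog : seq instr) (k : nat) (c : config) : option config :=
  match k with
  | 0 => Some c
  | k'.+1 => obind (step W prog) (run W prog k' c)
  end.

Definition init (input : seq nat) : config :=
  Config 0 (upd (fun _ => 0) 0 (size input)) (fun i => nth 0 input i).

Definition halted (prog : seq instr) (c : config) : bool :=
  if nth IHalt prog (pc c) is IHalt then true else false.

Definition halts_within (W : nat) (prog : seq instr) (input : seq nat) (T : nat)
  (Q : nat -> Prop) : Prop :=
  exists (j : nat) (c : config),
    j <= T /\ run W prog j (init input) = Some c /\ halted prog c /\ Q (reg c 0).

(* explicit encoding of the arena: p, n, m, then the m edges
   ((i,u),(i+1 mod p,v)) of D as triples i, u, v *)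
Definition encode (p n : nat) (l : seq (nat * 'I_n * 'I_n)) : seq nat :=
  [:: p; n; size l] ++ flatten [seq [:: e.1.1; val e.1.2; val e.2] | e <- l].

Definition edge_list (p n : nat) (E : nat -> rel 'I_n) (l : seq (nat * 'I_n * 'I_n)) : Prop :=
  uniq l /\ forall (i : nat) (u v : 'I_n), ((i, u, v) \in l) = (i < p) && E i u v.

(* Main.v *)
Require Import Defs.
From mathcomp Require Import all_boot.
From mathcomp Require Import zify.
Set Implicit Arguments. Unset Strict Implicit. Unset Printing Implicit Defensive.

(* The cop wins from (t, c, r), with the cop to move, iff some edge (t, c, c') leads to
   c' = r or to a position from which every robber edge (t, r, r') reaches a winning
   (t + 1, c', r').  A queue of winning states is initialised with the edges (t, c, r)
   themselves.  When (t, c, r) is taken from it, every edge (t - 1, r0, r) increments a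
   counter attached to (t - 1, c, r0); once this counter equals the out-degree of
   (t - 1, r0), the state (t - 1, c0, r0) wins for every edge (t - 1, c0, c).  The queue
   has at most p n^2 entries, and each of the two inner loops visits a pair (edge, vertex)
   at most once, hence n m visits.  Finitely many winning positions are uniform in the
   number of rounds left, which yields a cop strategy; the robber stays outside the final
   set of states, which is closed under the rules. *)

(** * A structured language and its compilation to the machine *)

(** The machine model adds two demands to the counting of visits. Values must stay below a fixed
    power of the input size: state codes run up to p n^2, and sinklessness bounds this by m^2 since
    it gives p n <= m. Time is a number of instructions: the algorithm is written in a small
    structured language with a ghost clock of loop passes, and one simulation theorem turns passes
    into instructions, with the program length as factor. Passes are charged to ghost lists. Each
    pass of an inner loop adds a fresh pair (edge, vertex) to a duplicate-free list [A] or [B], so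
    the amortised analysis reduces to a cardinality bound. Freshness comes from exact descriptions:
    [A] holds the robber edges into processed states, [B] the cop edges into positions whose counter
    is full. Read once the whole queue is processed, the same descriptions say that the queue is
    closed under the rules. The program is fixed while array lengths depend on p and n, which is why
    the arrays are interleaved in memory. *)

Inductive binop := Add | Sub | Mul | Div.

Inductive expr :=
| EVar of nat
| ECst of nat
| EIn of expr
| EArr of nat & expr
| EBin of binop & expr & expr.

Inductive cmd :=
| Skip
| Asg of nat & expr
| Sto of nat & expr & expr
| Seq of cmd & cmd
| If of expr & cmd & cmd
| While of expr & cmd.

(* [ticks] counts loop iterations only: between two backward jumps the machine executes
   at most as many instructions as the program has. *)
Record store := Store { var : nat -> nat; arr : nat -> nat -> nat; ticks : nat }.

Definition setv (s : store) r v := Store (upd (var s) r v) (arr s) (ticks s).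
Definition seta (s : store) a i v :=
  Store (var s) (fun b => if b == a then upd (arr s a) i v else arr s b) (ticks s).
Definition tick (s : store) := Store (var s) (arr s) (ticks s).+1.

Notation num_vars := 20 (only parsing).
Notation num_arrs := 6 (only parsing).

Definition evalb op x y :=
  match op with Add => x + y | Sub => x - y | Mul => x * y | Div => x %/ y end.

(** * Big-step semantics and total-correctness rules *)

Section Semantics.
Variables (inp : seq nat) (X : nat).

Fixpoint eval e s :=
  match e with
  | EVar r => var s r
  | ECst k => k
  | EIn e => nth 0 inp (eval e s)
  | EArr a e => arr s a (eval e s)
  | EBin op e1 e2 => evalb op (eval e1 s) (eval e2 s)
  end.

(** Guarantees evaluation without a crash. [Sub] and [Div] never exceed their first operand, so only
    [Add] and [Mul] are checked. An input index must stay inside the input because the cells after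
    it hold the arrays; variable 0 is excluded because register 0 keeps the input size. *)
Fixpoint ok e s : Prop :=
  match e with
  | EVar r => 0 < r < num_vars
  | ECst k => k < X
  | EIn e => [/\ ok e s, eval e s < size inp & nth 0 inp (eval e s) < X]
  | EArr a e => a < num_arrs /\ ok e s
  | EBin op e1 e2 => [/\ ok e1 s, ok e2 s &
      match op with
      | Add => eval e1 s + eval e2 s < X
      | Mul => eval e1 s * eval e2 s < X
      | _ => True end]
  end.

Inductive exec : cmd -> store -> store -> Prop :=
| exec_skip s : exec Skip s s
| exec_asg r e s : 0 < r < num_vars -> ok e s -> exec (Asg r e) s (setv s r (eval e s))
| exec_sto a i e s : a < num_arrs -> ok i s -> ok e s ->
    exec (Sto a i e) s (seta s a (eval i s) (eval e s))
| exec_seq c1 c2 s1 s2 s3 : exec c1 s1 s2 -> exec c2 s2 s3 -> exec (Seq c1 c2) s1 s3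
| exec_if e c1 c2 s s' : ok e s -> exec (if eval e s != 0 then c1 else c2) s s' ->
    exec (If e c1 c2) s s'
| exec_done e c s : ok e s -> eval e s = 0 -> exec (While e c) s s
| exec_loop e c s1 s2 s3 : ok e s1 -> eval e s1 != 0 -> exec c (tick s1) s2 ->
    exec (While e c) s2 s3 -> exec (While e c) s1 s3.

Lemma exec_ticks c s s' : exec c s s' -> ticks s <= ticks s'.
Proof.
elim=> //= {c s s'} [c1 c2 s1 s2 s3 _ H1 _ H2|e c s1 s2 s3 _ _ _ H1 _ H2].
  exact: leq_trans H1 H2.
exact: leq_trans (ltnW H1) H2.
Qed.

Definition wp c (Q : store -> Prop) s := exists2 s', exec c s s' & Q s'.

Lemma wp_skip (Q : store -> Prop) s : Q s -> wp Skip Q s.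
Proof. by exists s => //; constructor. Qed.

Lemma wp_asg r e (Q : store -> Prop) s :
  0 < r < num_vars -> ok e s -> Q (setv s r (eval e s)) -> wp (Asg r e) Q s.
Proof. by move=> *; exists (setv s r (eval e s)) => //; exact: exec_asg. Qed.

Lemma wp_sto a i e (Q : store -> Prop) s :
  a < num_arrs -> ok i s -> ok e s -> Q (seta s a (eval i s) (eval e s)) ->
  wp (Sto a i e) Q s.
Proof.
by move=> *; exists (seta s a (eval i s) (eval e s)) => //; exact: exec_sto.
Qed.

Lemma wp_seq c1 c2 Q s : wp c1 (wp c2 Q) s -> wp (Seq c1 c2) Q s.
Proof. by move=> [s1 H1 [s2 H2 ?]]; exists s2 => //; exact: exec_seq H1 H2. Qed.

Lemma wp_if e c1 c2 Q s :
  ok e s -> (eval e s != 0 -> wp c1 Q s) -> (eval e s = 0 -> wp c2 Q s) ->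
  wp (If e c1 c2) Q s.
Proof.
move=> oke H1 H2; case: (eqVneq (eval e s) 0) => [E|E].
  by have [s' ? ?] := H2 E; exists s' => //; apply: exec_if; rewrite // E.
by have [s' ? ?] := H1 E; exists s' => //; apply: exec_if; rewrite // E.
Qed.

(* An invariant that bounds the clock also ensures termination. *)
Lemma wp_while bnd (I : store -> Prop) e c (Q : store -> Prop) s :
  (forall s, I s -> ticks s <= bnd) ->
  (forall s, I s -> ok e s) ->
  (forall s, I s -> eval e s != 0 -> wp c I (tick s)) ->
  (forall s, I s -> eval e s = 0 -> Q s) ->
  I s -> wp (While e c) Q s.
Proof.
move=> Hb Hok Hc HQ; move: {2}(bnd - ticks s).+1 (ltnSn (bnd - ticks s)) => k.
elim: k s => // k IH s Hk Is.
case: (eqVneq (eval e s) 0) => [E|E].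
  by exists s; [apply: exec_done => //; exact: Hok|exact: HQ].
have [s1 ex1 Is1] := Hc _ Is E.
have := exec_ticks ex1; have := Hb _ Is; have := Hb _ Is1; rewrite /= => B1 B2 B3.
have [|s2 ex2 Q2] := IH s1 _ Is1; first by lia.
by exists s2 => //; apply: exec_loop ex1 ex2 => //; exact: Hok.
Qed.

End Semantics.

(** * Code generation and its correctness *)

Definition iop op :=
  match op with Add => IAdd | Sub => ISub | Mul => IMul | Div => IDiv end.

(* Array [a] at index [i] lives in the cell [size input + num_arrs * i + a];
   register 0 keeps [size input]. *)
Definition caddr d a :=
  [:: IConst d.+1 num_arrs; IMul d d d.+1; IConst d.+1 a; IAdd d d d.+1; IAdd d d 0].

(** The registers from [num_vars] up serve as an evaluation stack: the value is left in [d], and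
    registers below [d] are preserved. *)
Fixpoint cexpr d e :=
  match e with
  | EVar r => [:: IConst d 0; IAdd d d r]
  | ECst k => [:: IConst d k]
  | EIn e => cexpr d e ++ [:: ILoad d d]
  | EArr a e => cexpr d e ++ caddr d a ++ [:: ILoad d d]
  | EBin op e1 e2 => cexpr d e1 ++ cexpr d.+1 e2 ++ [:: iop op d d d.+1]
  end.

(** Jump targets are absolute, hence the parameter [o], the address at which the code is placed. *)
Fixpoint ccmd o c :=
  let d := num_vars in
  match c with
  | Skip => [::]
  | Asg r e => cexpr d e ++ [:: IConst d.+1 0; IAdd r d d.+1]
  | Sto a i e => cexpr d i ++ caddr d a ++ cexpr d.+1 e ++ [:: IStore d d.+1]
  | Seq c1 c2 => let k1 := ccmd o c1 in k1 ++ ccmd (o + size k1) c2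
  | If e c1 c2 =>
      let k := cexpr d e in
      let o1 := o + (size k + 1) in
      let k1 := ccmd o1 c1 in
      let o2 := o1 + (size k1 + 1) in
      let k2 := ccmd o2 c2 in
      k ++ [:: IJz d o2] ++ k1 ++ [:: IJmp (o2 + size k2)] ++ k2
  | While e c =>
      let k := cexpr d e in
      let o1 := o + (size k + 1) in
      let k1 := ccmd o1 c in
      k ++ [:: IJz d (o1 + (size k1 + 1))] ++ k1 ++ [:: IJmp o]
  end.

Section Compile.
Variables (inp : seq nat) (X W : nat) (prog : seq instr).

Definition code_at o k :=
  forall i, i < size k -> nth IHalt prog (o + i) = nth IHalt k i.

Lemma code_cat o k1 k2 :
  code_at o (k1 ++ k2) -> code_at o k1 /\ code_at (o + size k1) k2.
Proof.
move=> H; split=> i Hi.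
  by have := H i; rewrite size_cat nth_cat Hi; apply; lia.
have := H (size k1 + i); rewrite size_cat nth_cat addnA => -> //; last by lia.
have -> : size k1 + i < size k1 = false by lia.
by congr nth; lia.
Qed.

Lemma run_add j1 j2 c :
  run W prog (j1 + j2) c = obind (run W prog j2) (run W prog j1 c).
Proof.
elim: j2 => [|j2 IH]; first by rewrite addn0; case: run.
by rewrite addnS /= IH; case: (run W prog j1 c).
Qed.

Lemma run_cat j1 j2 c c1 c2 :
  run W prog j1 c = Some c1 -> run W prog j2 c1 = Some c2 ->
  run W prog (j1 + j2) c = Some c2.
Proof. by rewrite run_add => -> /=. Qed.


Definition istep i c :=
  match i with
  | IConst r k => setreg W c r k
  | IAdd r s t => setreg W c r (reg c s + reg c t)
  | ISub r s t => setreg W c r (reg c s - reg c t)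
  | IMul r s t => setreg W c r (reg c s * reg c t)
  | IDiv r s t => setreg W c r (reg c s %/ reg c t)
  | ILoad r s => setreg W c r (Defs.mem c (reg c s))
  | IStore r s =>
      Some (Config (pc c).+1 (reg c) (upd (Defs.mem c) (reg c r) (reg c s)))
  | IJz r l => Some (Config (if reg c r == 0 then l else (pc c).+1) (reg c) (Defs.mem c))
  | IJmp l => Some (Config l (reg c) (Defs.mem c))
  | IHalt => None
  end.

Lemma run1 i c : code_at (pc c) [:: i] -> run W prog 1 c = istep i c.
Proof. by move=> /(_ 0 isT); rewrite addn0 /= /step => ->. Qed.

(** Straight-line code, one step per instruction. Its placement is a premise inside the definition,
    so that [block_cat] composes blocks without tracking addresses. *)
Definition block k c c' :=
  code_at (pc c) k -> run W prog (size k) c = Some c' /\ pc c' = pc c + size k.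

Lemma block_cat k1 k2 c c1 c2 : block k1 c c1 -> block k2 c1 c2 -> block (k1 ++ k2) c c2.
Proof.
move=> H1 H2 /code_cat[A1 A2]; have [R1 P1] := H1 A1.
rewrite -P1 in A2; have [R2 P2] := H2 A2; rewrite size_cat; split.
  exact: run_cat R1 R2.
by rewrite P2 P1 addnA.
Qed.

Lemma block_one i c c' : istep i c = Some c' -> pc c' = (pc c).+1 -> block [:: i] c c'.
Proof. by move=> H P A; rewrite -[size _]/1 (run1 A) H P addn1. Qed.

Lemma block_cons i k c c1 c2 :
  istep i c = Some c1 -> pc c1 = (pc c).+1 -> block k c1 c2 -> block (i :: k) c c2.
Proof. by move=> H P B; apply: (@block_cat [:: i] k c c1 c2) => //; exact: block_one. Qed.

(** Registers from [num_vars] up are scratch space and stay unconstrained; [ticks] has no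
    counterpart in the machine. *)
Record sim s c : Prop := Sim {
  sim_base : reg c 0 = size inp;
  sim_var : forall r, 0 < r < num_vars -> reg c r = var s r;
  sim_in : forall i, i < size inp -> Defs.mem c i = nth 0 inp i;
  sim_arr : forall a i, a < num_arrs ->
    Defs.mem c (size inp + num_arrs * i + a) = arr s a i;
  sim_varX : forall r, var s r < X;
  sim_arrX : forall a i, arr s a i < X }.

Hypothesis hXW : num_arrs * X + num_arrs + size inp < W.
Hypothesis hX0 : 0 < X.

Lemma val_lt s c e : sim s c -> ok inp X e s -> eval inp e s < X.
Proof.
move=> S; elim: e => /= [r _|//|e _ []//|a e _ _|op e1 H1 e2 H2 []].
- exact: sim_varX S _.
- exact: sim_arrX S _ _.
move=> /H1 {}H1 /H2 {}H2; case: op => //= _.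
  by apply: leq_ltn_trans H1; rewrite leq_subr.
by apply: leq_ltn_trans H1; rewrite leq_div.
Qed.

Lemma block_addr s c0 c d a :
  sim s c0 -> num_vars <= d -> a < num_arrs -> reg c d < X -> reg c 0 = size inp ->
  exists c', [/\ block (caddr d a) c c', Defs.mem c' = Defs.mem c,
    reg c' d = size inp + num_arrs * reg c d + a &
    forall r, r < d -> reg c' r = reg c r].
Proof.
move=> S Hd Ha HX H0; have E0 : (0 == d) = false by lia.
have E1 : (d.+1 == d) = false by lia.
have E2 : (d == d.+1) = false by lia.
eexists; split.
- apply: block_cons; rewrite /= /setreg ?ifT //=; first by lia.
  apply: block_cons; rewrite /= /setreg /= /upd ?eqxx ?E0 ?E1 ?E2 ?ifT //=; first by lia.
  apply: block_cons; rewrite /= /setreg /= /upd ?eqxx ?E0 ?E1 ?E2 ?ifT //=; first by lia.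
  apply: block_cons; rewrite /= /setreg /= /upd ?eqxx ?E0 ?E1 ?E2 ?ifT //=; first by lia.
  apply: block_one; rewrite /= /setreg /= /upd ?eqxx ?E0 ?E1 ?E2 ?H0 ?ifT //=.
  by lia.
- by [].
- by rewrite /= /upd ?eqxx ?E0 ?E1 ?E2 /=; lia.
move=> r Hr; have F1 : (r == d) = false by lia.
have F2 : (r == d.+1) = false by lia.
by rewrite /= /upd F1 F2.
Qed.

Lemma block_expr s c0 e d c :
  sim s c0 -> num_vars <= d -> ok inp X e s -> Defs.mem c = Defs.mem c0 ->
  (forall r, r < num_vars -> reg c r = reg c0 r) ->
  exists c', [/\ block (cexpr d e) c c', Defs.mem c' = Defs.mem c,
    reg c' d = eval inp e s & forall r, r < d -> reg c' r = reg c r].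
Proof.
move=> S; elim: e d c => [r|k|e IH|a e IH|op e1 IH1 e2 IH2] d c Hd Hok Hm Hr.
- have rX := sim_varX S r; have E := sim_var S Hok; move/andP: Hok => [r0 rV].
  rewrite -Hr // in E.
  have E0 : (r == d) = false by lia.
  eexists; split.
  + apply: block_cons; rewrite /= /setreg ?ifT //=; first by lia.
    apply: block_one; rewrite /= /setreg /= /upd ?eqxx ?E0 ?ifT //=; lia.
  + by [].
  + by rewrite /= /upd !eqxx E.
  + by move=> r' Hr'; rewrite /= /upd; have -> : (r' == d) = false by lia.
- rewrite /= in Hok; eexists; split.
  + apply: block_one; rewrite /= /setreg ?ifT //=; lia.
  + by [].
  + by rewrite /= /upd eqxx.
  + by move=> r' Hr'; rewrite /= /upd; have -> : (r' == d) = false by lia.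
- case: Hok => oke lt1 lt2; have [c1 [B1 M1 V1 R1]] := IH d c Hd oke Hm Hr.
  eexists; split.
  + apply: (block_cat B1); apply: block_one.
      by rewrite /= /setreg V1 M1 Hm (sim_in S) // ifT //; lia.
    by [].
  + by [].
  + by rewrite /= /upd eqxx.
  + move=> r' Hr'; rewrite /= /upd; have -> : (r' == d) = false by lia.
    exact: R1.
- case: Hok => Ha oke; have [c1 [B1 M1 V1 R1]] := IH d c Hd oke Hm Hr.
  have vX := val_lt S oke.
  have [||c2 [B2 M2 V2 R2]] := block_addr (c := c1) S Hd Ha.
  + by rewrite V1.
  + by rewrite R1 ?Hr ?(sim_base S) //; exact: leq_trans Hd.
  have aX := sim_arrX S a (eval inp e s).
  eexists; split.
  + apply: (block_cat B1); apply: (block_cat B2); apply: block_one.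
      by rewrite /= /setreg V2 V1 M2 M1 Hm (sim_arr S) // ifT //; lia.
    by [].
  + by rewrite /= ?M2 ?M1.
  + by rewrite /= /upd eqxx.
  + move=> r' Hr'; rewrite /= /upd; have -> : (r' == d) = false by lia.
    by rewrite R2 // R1.
- case: (Hok) => ok1 ok2 Hop.
  have vX := val_lt S Hok.
  have [c1 [B1 M1 V1 R1]] := IH1 d c Hd ok1 Hm Hr.
  have [|||c2 [B2 M2 V2 R2]] := IH2 d.+1 c1 _ ok2.
  + exact: leqW.
  + by rewrite M1.
  + by move=> r rV; rewrite R1 ?Hr //; exact: leq_trans Hd.
  exists (Config (pc c2).+1 (upd (reg c2) d (eval inp (EBin op e1 e2) s)) (Defs.mem c2)).
  split.
  + apply: (block_cat B1); apply: (block_cat B2); apply: block_one => //.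
    have Rd : reg c2 d = eval inp e1 s by rewrite R2.
    by case: op Hop vX Hok => Hop vX Hok; rewrite /= /setreg Rd V2 ifT //;
      move: vX; rewrite /=; lia.
  + by rewrite /= ?M2 ?M1.
  + by rewrite /= /upd eqxx.
  + move=> r' Hr'; rewrite /= /upd; have -> : (r' == d) = false by lia.
    by rewrite R2 ?R1 //; exact: leqW.
Qed.

Lemma sim_scratch s c c' :
  sim s c -> Defs.mem c' = Defs.mem c -> (forall r, r < num_vars -> reg c' r = reg c r) ->
  sim s c'.
Proof.
move=> S M R; split; rewrite ?M; try by [exact: sim_in S|exact: sim_arr S].
- by rewrite R // (sim_base S).
- by move=> r Hr; rewrite R ?(sim_var S) //; case/andP: Hr.
- exact: sim_varX S.
- exact: sim_arrX S.
Qed.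

Lemma sim_tick s c : sim s c -> sim (tick s) c.
Proof. by case=> *; split. Qed.

Lemma sim_setv s c r v :
  sim s c -> v < X -> 0 < r -> sim (setv s r v) (Config (pc c).+1 (upd (reg c) r v) (Defs.mem c)).
Proof.
move=> [S1 S2 S3 S4 S5 S6] vX r0; split=> //=; rewrite /upd.
- by have -> : (0 == r) = false by lia.
- by move=> r' Hr'; case: eqP => // _; exact: S2.
- by move=> r'; case: eqP.
Qed.

(** Cells of distinct arrays never collide: the array number is below [num_arrs], hence it is the
    residue of the offset modulo [num_arrs]. *)
Lemma sim_seta s c a i v pc' :
  sim s c -> v < X -> a < num_arrs ->
  sim (seta s a i v)
    (Config pc' (reg c) (upd (Defs.mem c) (size inp + num_arrs * i + a) v)).
Proof.
move=> [S1 S2 S3 S4 S5 S6] vX Ha; split=> //=; rewrite /upd.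
- by move=> j Hj; case: eqP => [?|_]; [lia|exact: S3].
- move=> b j Hb; case: (eqVneq b a) => [->|E].
    case: (eqVneq j i) => [->|E']; first by rewrite eqxx.
    by rewrite ifF ?S4 //; apply/eqP; lia.
  by rewrite ifF ?S4 //; apply/eqP; lia.
- by move=> b j; case: eqP => // _; case: eqP.
Qed.

(** Amortised cost with potential [S * ticks]: a command may use its own length for free, and every
    further pass through a loop is paid by a tick. [S] is kept uniform so that the induction reaches
    subcommands with the factor of the whole program. *)
Lemma exec_compile c s s' :
  exec inp X c s s' ->
  forall S o cf, code_at o (ccmd o c) -> size (ccmd o c) <= S -> pc cf = o -> sim s cf ->
  exists j cf', [/\ run W prog j cf = Some cf', pc cf' = o + size (ccmd o c),
    sim s' cf' & j + S * ticks s <= size (ccmd o c) + S * ticks s'].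
Proof.
elim=> {c s s'} [s|r e s Hr oke|a i e s Ha oki oke|c1 c2 s1 s2 s3 _ IH1 _ IH2
  |e c1 c2 s s' oke _ IH|e c s oke Ve|e c s1 s2 s3 oke Ve _ IH1 _ IH2] S o cf A HS P Hs.
- by exists 0, cf; rewrite addn0.
- have [|c1 [B1 M1 V1 R1]] := block_expr (d := num_vars) Hs (leqnn _) oke (erefl _) => //.
  have vX := val_lt Hs oke.
  have B : block (ccmd o (Asg r e)) cf (Config (pc c1).+2
      (upd (upd (reg c1) num_vars.+1 0) r (eval inp e s)) (Defs.mem c1)).
    apply: (block_cat B1); apply: block_cons; rewrite /= /setreg ?ifT //=; first by lia.
    apply: block_one => //=; rewrite /setreg /=.
    have -> : upd (reg c1) num_vars.+1 0 num_vars = eval inp e s by [].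
    have -> : upd (reg c1) num_vars.+1 0 num_vars.+1 = 0 by [].
    by rewrite addn0 ifT //; lia.
  rewrite -P in A B *; have [R Q] := B A.
  exists (size (ccmd (pc cf) (Asg r e))); eexists; split; [exact: R|exact: Q| |by []].
  apply: (@sim_setv s (Config (pc c1).+1 (upd (reg c1) num_vars.+1 0) (Defs.mem c1))) => //.
    apply: (sim_scratch Hs) => //= r' Hr'; rewrite /upd -R1 //.
    by have -> : (r' == num_vars.+1) = false by lia.
  by case/andP: Hr.
- have [|c1 [B1 M1 V1 R1]] := block_expr (d := num_vars) Hs (leqnn _) oki (erefl _) => //.
  have iX := val_lt Hs oki; have vX := val_lt Hs oke.
  have [||c2 [B2 M2 V2 R2]] := block_addr (c := c1) Hs (leqnn _) Ha.
  + by rewrite V1.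
  + by rewrite R1 // (sim_base Hs).
  have [||c3 [B3 M3 V3 R3]] := block_expr (d := num_vars.+1) (c := c2) Hs (leqnSn _) oke.
  + by rewrite M2.
  + by move=> r Hr; rewrite R2 // R1.
  have B : block (ccmd o (Sto a i e)) cf (Config (pc c3).+1 (reg c3)
      (upd (Defs.mem c3) (size inp + num_arrs * eval inp i s + a) (eval inp e s))).
    apply: (block_cat B1); apply: (block_cat B2); apply: (block_cat B3).
    by apply: block_one => //=; rewrite V3 R3 // V2 V1.
  rewrite -P in A B *; have [R Q] := B A.
  exists (size (ccmd (pc cf) (Sto a i e))); eexists; split; [exact: R|exact: Q| |by []].
  apply: sim_seta => //; apply: (sim_scratch Hs); first by rewrite M3 M2.
  by move=> r Hr; rewrite R3 ?R2 ?R1 //; exact: leqW.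
- rewrite /= in A HS *; have [A1 A2] := code_cat A; rewrite size_cat in HS *.
  have [|j1 [f1 [R1 P1 S1 T1]]] := IH1 S o cf A1 _ P Hs; first by lia.
  have [|j2 [f2 [R2 P2 S2 T2]]] := IH2 S _ f1 A2 _ P1 S1; first by lia.
  exists (j1 + j2), f2; split=> //; [exact: run_cat R1 R2|by rewrite P2; lia|lia].
- rewrite /= in A HS *; set k := cexpr _ e in A HS *.
  set k1 := ccmd _ c1 in A HS *; set k2 := ccmd _ c2 in A HS *.
  have [A1 {}A] := code_cat A; have [A2 {}A] := code_cat (k1 := [:: _]) A.
  have [A3 {}A] := code_cat A; have [A4 A5] := code_cat (k1 := [:: _]) A.
  rewrite ?size_cat /= ?size_cat /= in A2 A3 A4 A5 HS *.
  have [|f [B1 M1 V1 F1]] := block_expr (d := num_vars) Hs (leqnn _) oke (erefl _) => //.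
  rewrite -{1}P in A1; have [R1 P1] := B1 A1; rewrite -/k in R1 P1.
  have := run1 (i := IJz num_vars (o + (size k + 1) + (size k1 + 1))) (c := f).
  rewrite P1 P => /(_ A2) /=; rewrite V1 => R2; rewrite P1 P in R2.
  have Hs2 q : sim s (Config q (reg f) (Defs.mem f)) by apply: (sim_scratch Hs).
  case: eqP R2 IH => [E|E] R2 /= IH.
    have [||j [f' [R3 P3 S3 T3]]] := IH S (o + (size k + 1) + (size k1 + 1))
      (Config (o + (size k + 1) + (size k1 + 1)) (reg f) (Defs.mem f))
      _ _ (erefl _) (Hs2 _).
    + by move: A5; rewrite -/k2; congr code_at; lia.
    + by rewrite /= -/k2; lia.
    rewrite /= -/k2 in P3 T3.
    exists (size k + (1 + j)), f'; split=> //; last by rewrite -/k2 in T3 *; lia.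
    * exact: (run_cat R1 (run_cat (j1 := 1) R2 R3)).
    * by rewrite P3 -/k2; lia.
  have [|||j [f' [R3 P3 S3 T3]]] := IH S (o + (size k + 1))
    (Config (o + size k).+1 (reg f) (Defs.mem f)) _ _ _ (Hs2 _).
  + by move: A3; rewrite -/k1; congr code_at; lia.
  + by rewrite -/k1; lia.
  + by rewrite /=; lia.
  have R4 := run1 (i := IJmp (o + (size k + 1) + (size k1 + 1) + size k2)) (c := f').
  rewrite P3 -/k1 in R4; have {}R4 := R4 _.
  exists (size k + (1 + (j + 1))); eexists; split.
  + apply: (run_cat R1 (run_cat (j1 := 1) R2 (run_cat (j2 := 1) R3 _))); apply: R4.
    by move: A4; congr code_at; lia.
  + by rewrite /=; lia.
  + exact: (sim_scratch S3).
  + by rewrite -/k1 in T3; lia.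
- rewrite /= in A HS *; set k := cexpr _ e in A HS *; set k1 := ccmd _ c in A HS *.
  have [A1 {}A] := code_cat A; have [A2 _] := code_cat (k1 := [:: _]) A.
  rewrite ?size_cat /= ?size_cat /= in A2 HS *.
  have [|f [B1 M1 V1 F1]] := block_expr (d := num_vars) Hs (leqnn _) oke (erefl _) => //.
  rewrite -{1}P in A1; have [R1 P1] := B1 A1; rewrite -/k in R1 P1.
  have := run1 (i := IJz num_vars (o + (size k + 1) + (size k1 + 1))) (c := f).
  rewrite P1 P => /(_ A2) /=; rewrite V1 Ve /= => R2.
  exists (size k + 1); eexists; split; [exact: (run_cat (j2 := 1) R1 R2)| | |].
  + by rewrite /=; lia.
  + exact: (sim_scratch Hs).
  + by lia.
rewrite /=; set k := cexpr _ e; set k1 := ccmd _ c.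
have A' := A; have HS' := HS.
rewrite /= -/k -/k1 in A' HS'.
have [A1 {}A'] := code_cat A'; have [A2 {}A'] := code_cat (k1 := [:: _]) A'.
have [A3 A4] := code_cat A'.
rewrite ?size_cat /= ?size_cat /= in A2 A3 A4 HS' *.
have [|f [B1 M1 V1 F1]] := block_expr (d := num_vars) Hs (leqnn _) oke (erefl _) => //.
rewrite -{1}P in A1; have [R1 P1] := B1 A1; rewrite -/k in R1 P1.
have := run1 (i := IJz num_vars (o + (size k + 1) + (size k1 + 1))) (c := f).
rewrite P1 P => /(_ A2) /=; rewrite V1 (negbTE Ve) P1 P => R2.
have Hs2 q : sim s1 (Config q (reg f) (Defs.mem f)) by apply: (sim_scratch Hs).
have [|||j1 [f1 [R3 P3 S3 T3]]] := IH1 S (o + (size k + 1))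
  (Config (o + size k).+1 (reg f) (Defs.mem f)) _ _ _ (sim_tick (Hs2 _)).
- by move: A3; rewrite -/k1; congr code_at; lia.
- by rewrite -/k1; lia.
- by rewrite /=; lia.
rewrite -/k1 /= in P3 T3.
have R4 := run1 (i := IJmp o) (c := f1); rewrite P3 /= in R4.
have [||j2 [f2 [R5 P5 S5 T5]]] := IH2 S o (Config o (reg f1) (Defs.mem f1)) A HS.
- by [].
- exact: (sim_scratch S3).
exists (size k + (1 + (j1 + (1 + j2)))), f2; split=> //.
- apply: (run_cat R1 (run_cat (j1 := 1) R2 (run_cat R3 (run_cat (j1 := 1) _ R5)))); apply: R4.
  by move: A4; congr code_at; lia.
- by rewrite P5 /= -/k -/k1 ?size_cat /= ?size_cat /=.
(* The tick of this pass yields [S], which covers the test, the body and both jumps; the length of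
   the loop itself remains available for the later passes. *)
move: T5; rewrite /= -/k -/k1 ?size_cat /= ?size_cat /=; lia.
Qed.

End Compile.

Definition output_code out := [:: IConst num_vars 0; IAdd 0 num_vars out; IHalt].

Definition start := Store (fun _ => 0) (fun _ _ => 0) 0.

Lemma wp_halts (inp : seq nat) X W c out T (Q : nat -> Prop) :
  num_arrs * X + num_arrs + size inp < W -> 0 < X -> 0 < out < num_vars ->
  wp inp X c (fun s => ticks s <= T /\ Q (var s out)) start ->
  halts_within W (ccmd 0 c ++ output_code out) inp
    ((size (ccmd 0 c)).+2 * T + (size (ccmd 0 c)).+2) Q.
Proof.
move=> hXW hX0 Hout [s' ex [Ts' Qs']].
set prog := ccmd 0 c ++ output_code out.
have A : code_at prog 0 prog by [].
have [A1 A2] := code_cat A; rewrite add0n in A2.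
have [|j [c1 [R1 P1 S1 T1]]] :=
    exec_compile (W := W) hXW hX0 ex A1 (leqnn _) (erefl (pc (init inp))) _.
  (* Memory past the input reads as zero, so all arrays start cleared at no cost. *)
  split=> //= [[|r]//|a i _].
  by rewrite nth_default //; lia.
have [|||R2 P2] := @block_cat W prog [:: IConst num_vars 0] [:: IAdd 0 num_vars out] c1
  (Config (pc c1).+1 (upd (reg c1) num_vars 0) (Defs.mem c1))
  (Config (pc c1).+2 (upd (upd (reg c1) num_vars 0) 0 (var s' out)) (Defs.mem c1)).
- by apply: block_one => //=; rewrite /setreg ifT //; lia.
- apply: block_one => //=; rewrite /setreg /= {1 3}/upd /=.
  have E : out == num_vars = false by lia.
  rewrite add0n /upd E (sim_var S1) // ifT //.
  by have := sim_varX S1 out; lia.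
- by move=> i Hi; rewrite P1 add0n A2 //; case: i Hi => [|[|]].
exists (j + 2); eexists; split; last split; [|exact: run_cat R1 R2|].
  (* The two instructions that copy the answer to register 0 account for the [.+2]. *)
  by rewrite /= in T1; move: T1 Ts'; rewrite muln0; nia.
split; last by rewrite /= /upd.
rewrite /halted P2 P1 /= add0n.
by rewrite (A2 2).
Qed.

(** * Layout of the input *)

Section Encoding.
Variables (p n : nat) (l : seq (nat * 'I_n * 'I_n)).

Lemma size_encode : size (encode p l) = 3 * size l + 3.
Proof.
rewrite /encode size_cat size_flatten /shape -map_comp /=.
by elim: l => //= e l' IH; lia.
Qed.

Lemma nth_encode x0 j : j < size l ->
  [/\ nth 0 (encode p l) (3 * j + 3) = (nth x0 l j).1.1,
      nth 0 (encode p l) (3 * j + 4) = (nth x0 l j).1.2 &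
      nth 0 (encode p l) (3 * j + 5) = (nth x0 l j).2].
Proof.
rewrite /encode !nth_cat /= !ifF; try lia.
rewrite (_ : 3 * j + 3 - 3 = 3 * j); last lia.
rewrite (_ : 3 * j + 4 - 3 = 3 * j + 1); last lia.
rewrite (_ : 3 * j + 5 - 3 = 3 * j + 2); last lia.
elim: l j => //= e l' IH [|j] // /IH {IH}[H1 H2 H3].
rewrite (_ : 3 * j.+1 = (3 * j).+3) /=; last lia.
by [].
Qed.

End Encoding.

(** * The game *)

Section Game.
Variables (p n : nat) (E : nat -> rel 'I_n).
Hypotheses (p_gt0 : 0 < p) (hE : sinkless p E).

Fixpoint win k t (c r : 'I_n) : bool :=
  if k is k'.+1 then
    [exists c', Gamma p E t c c' &&
      ((c' == r) || [forall r', Gamma p E t r r' ==> win k' t.+1 c' r'])]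
  else false.

Lemma win_modn k t t' c r : t = t' %[mod p] -> win k t c r = win k t' c r.
Proof.
elim: k t t' c r => //= k IH t t' c r Ht; apply: eq_existsb => c'.
rewrite /Gamma Ht; congr (_ && (_ || _)); apply: eq_forallb => r'; congr (_ ==> _).
by apply: IH; rewrite -addn1 -(addn1 t') -modnDml Ht modnDml.
Qed.

Lemma win_leq k k' t c r : k <= k' -> win k t c r -> win k' t c r.
Proof.
elim: k k' t c r => // k IH [//|k'] t c r Hk /existsP[c' /andP[G H]].
apply/existsP; exists c'; rewrite G /=; case/orP: H => [->//|/forallP H].
by apply/orP; right; apply/forallP => r'; apply/implyP => /(implyP (H r')); exact: IH.
Qed.

(** Monotonicity in [k] allows taking the maximum of finitely many bounds. It serves twice: over the
    starting vertices of the robber, and over the robber's replies in [sound_rcons]. *)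
Lemma win_uniform (I : finType) (P : pred I) t (c r : I -> 'I_n) :
  (forall i, P i -> exists k, win k t (c i) (r i)) ->
  exists k, forall i, P i -> win k t (c i) (r i).
Proof.
move=> H; have [i|f Hf] := @fin_all_exists I (fun=> nat) (fun i k => P i -> win k t (c i) (r i)).
  by case: (boolP (P i)) => [/H[k]|_]; [exists k|exists 0].
exists (\max_i f i) => i /(Hf i); apply: win_leq; exact: leq_bigmax.
Qed.

Lemma size_play c0 r0 sc sr t : size (@play n c0 r0 sc sr t) = t.+1.
Proof. by elim: t => //= t IH; rewrite size_rcons IH. Qed.

Lemma play_rcons c0 r0 sc sr t : exists h c r,
  [/\ @play n c0 r0 sc sr t = rcons h (c, r), size h = t &
      forall x, last x (@play n c0 r0 sc sr t) = (c, r)].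
Proof.
have := size_play c0 r0 sc sr t; case/lastP: (play _ _ _ _ _) => // h [c r].
by rewrite size_rcons => -[<-]; exists h, c, r; split=> // x; rewrite last_rcons.
Qed.

Lemma ex_edge t u : exists v, Gamma p E t u v.
Proof. by apply: hE; rewrite ltn_mod. Qed.

(** Legality quantifies over all histories, including those that never arise, so each strategy needs
    a legal default; sinklessness provides it. *)
Definition some_move t u := odflt u [pick v | Gamma p E t u v].

Lemma some_moveP t u : Gamma p E t u (some_move t u).
Proof.
rewrite /some_move; case: pickP => //= H.
by have [v] := ex_edge t u; rewrite H.
Qed.

Lemma copwin_of_win (c0 : 'I_n) : (forall r, exists k, win k 0 c0 r) -> copwin p E.
Proof.
move=> H; have [r _|K HK] := @win_uniform 'I_n predT 0 (fun=> c0) id.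
  exact: H.
(* After the move of round [t], [K - t.+1] rounds are left; the strategy reads its remaining budget
   off the length of the history. *)
pose good t c r c' := Gamma p E t c c' &&
  ((c' == r) || [forall r', Gamma p E t r r' ==> win (K - t.+1) t.+1 c' r']).
pose sc (h : history n) := let t := (size h).-1 in let cr := last (c0, c0) h in
  odflt (some_move t cr.1) [pick c' | good t cr.1 cr.2 c'].
exists c0, sc; split.
  move=> h c r; rewrite /sc size_rcons last_rcons /=.
  by case: pickP => [c' /andP[]//|_]; exact: some_moveP.
move=> r0 sr Hsr.
(* At [t = K] the second alternative becomes [win 0], which is false, so a capture has occurred. *)
have inv t : t <= K -> (exists t, captured_at c0 r0 sc sr t) \/
    let cr := last (c0, c0) (play c0 r0 sc sr t) in win (K - t) t cr.1 cr.2.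
  elim: t => [_|t IH Ht].
    by right; rewrite subn0; exact: HK.
  have [|//|W] := IH; [exact: ltnW|by left|].
  have [h [c [r [Eh Sh Lh]]]] := play_rcons c0 r0 sc sr t.
  rewrite Lh /= in W.
  case Kt: (K - t) W => [|k] // /existsP[c1 G1].
  have Ek : K - t.+1 = k by lia.
  have gc : good t c r (sc (rcons h (c, r))).
    rewrite /sc size_rcons last_rcons Sh /=; case: pickP => //= /(_ c1).
    by rewrite /good Ek G1.
  case/andP: gc => _ /orP[/eqP gc|/forallP gc].
    by left; exists t; rewrite /captured_at Lh Eh.
  right; rewrite /= last_rcons Eh /=.
  by have := gc (sr (rcons h (c, r)) (sc (rcons h (c, r)))); rewrite -{1}Sh Hsr.
by have [//|] := inv K (leqnn K); rewrite subnn.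
Qed.

Definition cpre (S : nat -> 'I_n -> 'I_n -> bool) t c r := exists c',
  Gamma p E t c c' /\ (c' = r \/ forall r', Gamma p E t r r' -> S t.+1 c' r').

(* Outside a set closed under the controlled predecessor, the robber can stay outside. *)
Lemma closed_of_copwin (S : nat -> 'I_n -> 'I_n -> bool) :
  (forall t c r, cpre S t c r -> S t c r) -> copwin p E ->
  exists c, forall r, S 0 c r.
Proof.
move=> HS [c0 [sc [Hsc Hwin]]]; exists c0 => r0; apply/negPn/negP => N0.
pose sr (h : history n) (c' : 'I_n) := let t := (size h).-1 in let r := (last (r0, r0) h).2 in
  odflt (some_move t r) [pick r' | Gamma p E t r r' && ~~ S t.+1 c' r'].
have Hsr : legal_robber p E sr.
  move=> h c r c'; rewrite /sr size_rcons last_rcons /=.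
  by case: pickP => [r' /andP[]//|_]; exact: some_moveP.
have [t] := Hwin r0 sr Hsr.
have inv : forall t, let cr := last (c0, r0) (play c0 r0 sc sr t) in ~~ S t cr.1 cr.2.
  elim=> [//|{}t IH]; have [h [c [r [Eh Sh Lh]]]] := play_rcons c0 r0 sc sr t.
  rewrite Lh /= in IH; rewrite /= last_rcons Eh /=; set c' := sc _.
  rewrite /sr size_rcons last_rcons Sh /=; case: pickP => [r' /andP[]//|H].
  case/negP: IH; apply: HS; exists c'; split; first by rewrite -Sh; exact: Hsc.
  by right=> r' G; have := H r'; rewrite G /= => /negbFE.
have [h [c [r [Eh Sh Lh]]]] := play_rcons c0 r0 sc sr t.
rewrite /captured_at Lh Eh /= => C.
(* A capturing move puts the position in [S] by the first disjunct of [cpre], against the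
   invariant. *)
have := inv t; rewrite Lh /= => /negP; apply; apply: HS; exists r.
by split; [rewrite -C -Sh; exact: Hsc|left].
Qed.

End Game.

(** * The worklist algorithm *)

(** This is why comparing a counter with a degree decides a universal statement about the robber's
    replies. *)
Lemma count_all_imply (T : Type) (a b : pred T) s :
  (count (fun x => a x && b x) s == count a s) = all (fun x => a x ==> b x) s.
Proof.
elim: s => //= x s <-; have : count (fun x => a x && b x) s <= count a s.
  by apply: sub_count => y /andP[].
by case: (a x); case: (b x) => //=; rewrite ?add0n ?add1n ?eqSS //; lia.
Qed.

Lemma count_or_pred1 (T : eqType) (a : pred T) s x :
  uniq s -> x \in s -> ~~ a x -> count (fun y => a y || (y == x)) s = (count a s).+1.
Proof.
move=> us xs ax; rewrite (eq_count (a2 := predU a (pred1 x))) //.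
have := count_predUI a (pred1 x) s.
have -> : count (predI a (pred1 x)) s = 0.
  rewrite (eq_count (a2 := pred0)) ?count_pred0 // => y /=.
  by apply/negbTE/negP => /andP[ay /eqP yx]; rewrite -yx ay in ax.
by rewrite (count_uniq_mem _ us) xs; lia.
Qed.

(** Machine subtraction truncates, so the round preceding [t] is formed as [t + p - 1] and then
    reduced modulo [p]. *)
Lemma modn_succ_pred p s t : s < p -> t < p ->
  (s.+1 %% p == t) = (s == (t + p - 1) %% p).
Proof.
move=> sp tp; case: (ltnP s.+1 p) => sp'.
  rewrite modn_small //; case: t tp => [|t] tp.
    by rewrite add0n modn_small; lia.
  by rewrite (_ : t.+1 + p - 1 = t + p) ?modnDr ?modn_small; lia.
have -> : s.+1 = p by lia.
rewrite modnn; case: t tp => [|t] tp.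
  by rewrite add0n modn_small; lia.
by rewrite (_ : t.+1 + p - 1 = t + p) ?modnDr ?modn_small; lia.
Qed.

(** * Numbering of states, and cardinality bounds on states and pairs *)

Section Index.
Variable n : nat.
Implicit Types (u v : 'I_n) (x y : nat * 'I_n * 'I_n).

Definition code x := (x.1.1 * n + x.1.2) * n + x.2.

Lemma index_inj i j u v : i * n + u = j * n + v -> i = j /\ u = v.
Proof.
move=> H; have n0 : 0 < n by case: n u {v H} => // -[].
have := congr1 (divn^~ n) H; rewrite !divnMDl // !divn_small // !addn0 => E.
by split=> //; apply: val_inj; rewrite /= E in H *; lia.
Qed.

Lemma code_inj : injective code.
Proof.
move=> [[i u] v] [[j w] z] /index_inj[/index_inj[/= -> ->] /= ->] //.
Qed.

Lemma index_lt p i v : i < p -> i * n + v < p * n.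
Proof. by move=> ip; have := leq_mul ip (leqnn n); rewrite mulSn; have := ltn_ord v; lia. Qed.

Lemma code_lt p x : x.1.1 < p -> code x < p * n * n.
Proof.
move=> /(index_lt x.1.2) H; have := leq_mul H (leqnn n); rewrite mulSn /code.
by have := ltn_ord x.2; lia.
Qed.

Lemma size_states p (q : seq (nat * 'I_n * 'I_n)) :
  uniq q -> (forall x, x \in q -> x.1.1 < p) -> size q <= p * n * n.
Proof.
move=> uq qp; rewrite -(size_map code) -(size_iota 0 (p * n * n)).
apply: uniq_leq_size; first by rewrite map_inj_uniq //; exact: code_inj.
by move=> _ /mapP[x xq ->]; rewrite mem_iota /= add0n code_lt // qp.
Qed.

(** Applied to the ghost lists [A] and [B], this is the source of the term n m of the running
    time. *)
Lemma size_pairs (T : eqType) (l : seq T) (A : seq (T * 'I_n)) :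
  uniq A -> (forall a, a \in A -> a.1 \in l) -> size A <= size l * n.
Proof.
move=> uA Al; rewrite -{2}(card_ord n) cardE -(size_allpairs pair); apply: uniq_leq_size => //.
by move=> [e c] /Al el; apply: allpairs_f => //; rewrite mem_enum.
Qed.

End Index.

(** * The set of winning states, its counters and its linked lists *)

Section Attractor.
Variables (p n : nat) (E : nat -> rel 'I_n) (l : seq (nat * 'I_n * 'I_n)).
Hypotheses (p_gt0 : 0 < p) (hE : sinkless p E) (hl : edge_list p E l).
Implicit Types (q : seq (nat * 'I_n * 'I_n)) (A B : seq ((nat * 'I_n * 'I_n) * 'I_n)).

(** Sinklessness gives each pair (i, u) an edge of its own. This keeps p, n and all state codes
    polynomial in the input size. *)
Lemma size_edges_ge : p * n <= size l.
Proof.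
have -> : p * n = size [seq (i, u) | i <- iota 0 p, u <- enum 'I_n].
  by rewrite size_allpairs size_iota size_enum_ord.
rewrite -(size_map fst l); apply: uniq_leq_size.
  by apply: allpairs_uniq; rewrite ?iota_uniq ?enum_uniq // => -[? ?] [? ?].
move=> _ /allpairsP[[i u] /= [ip _ ->]]; rewrite mem_iota /= add0n in ip.
have [v Ev] := hE ip u; apply/mapP; exists (i, u, v) => //.
by rewrite hl.2 ip Ev.
Qed.

Lemma edge_mem i u v : i < p -> ((i, u, v) \in l) = E i u v.
Proof. by rewrite hl.2 => ->. Qed.

Lemma edge_time e : e \in l -> e.1.1 < p.
Proof. by case: e => [[i u] v]; rewrite hl.2 => /andP[]. Qed.

Definition full A i (c r : 'I_n) := all (fun e => (e.1 == (i, r)) ==> ((e, c) \in A)) l.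

Definition sound q :=
  forall x, x \in q -> x.1.1 < p /\ exists k, win p E k x.1.1 x.1.2 x.2.

Lemma sound_edges : sound l.
Proof.
move=> [[i u] v] el; have ip := edge_time el; split=> //; exists 1 => /=.
apply/existsP; exists v; rewrite eqxx /= andbT /Gamma modn_small //.
by rewrite -edge_mem.
Qed.

Lemma sound_rcons q f r :
  sound q -> f \in l ->
  (forall e, e \in l -> e.1 = (f.1.1, r) -> (f.1.1.+1 %% p, f.2, e.2) \in q) ->
  sound (rcons q (f.1.1, f.1.2, r)).
Proof.
case: f => [[i u] v] /= sq fl H x; rewrite mem_rcons inE => /orP[/eqP->|]; last exact: sq.
have ip : i < p by exact: edge_time fl.
split=> //=; have [r'|k Hk] := @win_uniform p n E 'I_n (E i r) i.+1 (fun=> v) id.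
  rewrite -edge_mem // => el; have [_ [k /= W]] := sq _ (H _ el (erefl _)).
  by exists k; rewrite (@win_modn _ _ _ _ _ (i.+1 %% p)) // modn_mod.
exists k.+1; apply/existsP; exists v; rewrite /Gamma modn_small // -edge_mem // fl /=.
by apply/orP; right; apply/forallP => r'; apply/implyP => /Hk.
Qed.

(** Soundness gives the implication from right to left by [copwin_of_win]; the two closure
    properties give the converse by [closed_of_copwin], applied to [q] with times reduced modulo
    [p]. *)
Lemma copwin_closed q :
  sound q -> {subset l <= q} ->
  (forall f r, f \in l ->
     (forall e, e \in l -> e.1 = (f.1.1, r) -> (f.1.1.+1 %% p, f.2, e.2) \in q) ->
     (f.1.1, f.1.2, r) \in q) ->
  copwin p E <-> exists c, forall r, (0, c, r) \in q.
Proof.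
move=> sq lq cq; split; last first.
  by move=> [c Hc]; apply: (copwin_of_win p_gt0 hE (c0 := c)) => r; have [_] := sq _ (Hc r).
move=> /(@closed_of_copwin p n E p_gt0 hE (fun t c r => (t %% p, c, r) \in q))[].
  move=> t c r [c' [G Hc']]; have tp : t %% p < p by rewrite ltn_mod.
  have fl : (t %% p, c, c') \in l by rewrite edge_mem.
  case: Hc' => [<-|Hr]; first exact: lq.
  apply: (cq _ r fl) => -[[i u] v] el /= [Ei Eu]; subst i u.
  have := Hr v; rewrite -addn1 -modnDml addn1; apply.
  by rewrite /Gamma -edge_mem.
by move=> c Hc; exists c => r; have := Hc r; rewrite mod0n.
Qed.

(** A vertex without out-edges would be full vacuously, before any counter moved. Sinklessness
    excludes this, so a position can become full only through an increment. *)
Lemma not_full A i c r : i < p -> (forall e, e \in l -> e.1 = (i, r) -> (e, c) \notin A) ->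
  full A i c r = false.
Proof.
move=> ip H; have [v Ev] := hE ip r; apply/negbTE/negP => /allP /(_ (i, r, v)).
rewrite edge_mem // Ev eqxx => /(_ isT) /=.
by apply/negP/H; rewrite // edge_mem.
Qed.

Definition degree i u := count (fun e => e.1 == (i, u)) l.
Definition counter A i c r := count (fun e => (e.1 == (i, r)) && ((e, c) \in A)) l.

Lemma counter_full A i c r : (counter A i c r == degree i r) = full A i c r.
Proof. exact: count_all_imply. Qed.

Lemma counter_cons A e c i c' r :
  e \in l -> (e, c) \notin A ->
  counter ((e, c) :: A) i c' r = counter A i c' r + ((i, c', r) == (e.1.1, c, e.1.2)).
Proof.
move=> el eA; case: eqP => [[-> -> ->]|N]; last first.
  rewrite addn0; apply: eq_count => e' /=; case: eqP => //= Ee'.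
  rewrite inE; case: eqP => // -[? ?]; subst e' c'.
  by case: N; rewrite Ee'.
rewrite addn1 -(count_or_pred1 hl.1 el); last by rewrite (negbTE eA) andbF.
apply: eq_count => e'; rewrite inE xpair_eqE eqxx andbT.
case: (eqVneq e' e) => [->|//]; last by rewrite orbF.
by rewrite -surjective_pairing eqxx orbT.
Qed.

Definition in_edges i v (s : seq (nat * 'I_n * 'I_n)) :=
  [seq e <- rev s | (e.1.1 == i) && (e.2 == v)].

Lemma mem_in_edges i v s e :
  (e \in in_edges i v s) = [&& e.1.1 == i, e.2 == v & e \in s].
Proof. by rewrite mem_filter mem_rev andbA. Qed.

Lemma in_edges_uniq i v : uniq (in_edges i v l).
Proof. by rewrite filter_uniq // rev_uniq; exact: hl.1. Qed.

Fixpoint chain (nxt : nat -> nat) h (es : seq (nat * 'I_n * 'I_n)) : Prop :=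
  if es is e :: es' then h = (index e l).+1 /\ chain nxt (nxt h) es' else h = 0.

(** Frame property: writing a cell outside the list leaves the list intact. *)
Lemma eq_chain nxt nxt' h es :
  (forall e, e \in es -> nxt (index e l).+1 = nxt' (index e l).+1) ->
  chain nxt h es -> chain nxt' h es.
Proof.
elim: es h => //= e es IH h H [-> C]; split=> //; rewrite -H ?mem_head //.
by apply: IH C => e' Ee'; apply: H; rewrite inE Ee' orbT.
Qed.

(** Recovers the rest of a traversal from the current edge and the full list, with no memory of the
    pointers followed so far. *)
Lemma chain_cat nxt h es e es' :
  chain nxt h (es ++ e :: es') -> chain nxt (nxt (index e l).+1) es'.
Proof. by elim: es h => [|e' es IH] h /= [H]; [rewrite H|exact: IH]. Qed.

End Attractor.

(** * Concrete syntax and the program *)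

Notation vn := 1 (only parsing).
Notation vp := 2 (only parsing).
Notation vm := 3 (only parsing).
Notation ve := 4 (only parsing).
Notation vi := 5 (only parsing).
Notation vu := 6 (only parsing).
Notation vv := 7 (only parsing).
Notation vtl := 8 (only parsing).
Notation vhd := 9 (only parsing).
Notation vx := 10 (only parsing).
Notation vs := 11 (only parsing).
Notation vc := 12 (only parsing).
Notation vr := 13 (only parsing).
Notation vr0 := 14 (only parsing).
Notation vf := 15 (only parsing).
Notation vk := 16 (only parsing).
Notation vout := 17 (only parsing).
Notation vc0 := 18 (only parsing).

(* Edges are numbered from 1; HEAD and NEXT store the linked lists of the edges that enter
   a vertex of the arena, with 0 as end marker. *)
Notation aHEAD := 0 (only parsing).
Notation aNEXT := 1 (only parsing).
Notation aDEG := 2 (only parsing).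
Notation aMARK := 3 (only parsing).
Notation aCNT := 4 (only parsing).
Notation aQU := 5 (only parsing).

Declare Scope prog_scope.
Delimit Scope prog_scope with P.
Coercion EVar : nat >-> expr.
Notation "# k" := (ECst k) (at level 8, k at level 0, format "# k") : prog_scope.
Notation "a + b" := (EBin Add a b) : prog_scope.
Notation "a - b" := (EBin Sub a b) : prog_scope.
Notation "a * b" := (EBin Mul a b) : prog_scope.
Notation "a %/ b" := (EBin Div a b) : prog_scope.
Notation "a @[ i ]" := (EArr a i) (at level 2, left associativity, format "a @[ i ]") : prog_scope.
Notation "x ::= e" := (Asg x e%P) (at level 90) : prog_scope.
Arguments Sto _ _%_P _%_P.
Notation "c1 ;; c2" := (Seq c1%P c2%P) (at level 100, right associativity) : prog_scope.

(** The increment of [ve] comes halfway: before it, [ve] addresses the input and the queue from 0;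
    after it, [ve] is the edge number, counted from 1. *)
Definition build_loop : cmd := (
  While (vm - ve) (
    vi ::= EIn (#3 * ve + #3);;
    vu ::= EIn (#3 * ve + #4);;
    vv ::= EIn (#3 * ve + #5);;
    vk ::= (vi * vn + vu) * vn + vv;;
    Sto aMARK vk (#1);;
    Sto aQU ve vk;;
    ve ::= ve + #1;;
    Sto aNEXT ve (aHEAD@[vi * vn + vv]);;
    Sto aHEAD (vi * vn + vv) ve;;
    Sto aDEG (vi * vn + vu) (aDEG@[vi * vn + vu] + #1)))%P.

Definition cop_loop : cmd := (
  While vf (
    vc0 ::= EIn (#3 * vf + #1);;
    vk ::= (vs * vn + vc0) * vn + vr0;;
    If (aMARK@[vk]) Skip (
      Sto aMARK vk (#1);;
      Sto aQU vtl vk;;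
      vtl ::= vtl + #1);;
    vf ::= aNEXT@[vf]))%P.

(** The truncated difference of degree and counter vanishes iff the counter has reached the degree,
    since it never exceeds it ([counter_le]). *)
Definition robber_loop : cmd := (
  While ve (
    vr0 ::= EIn (#3 * ve + #1);;
    vk ::= (vs * vn + vc) * vn + vr0;;
    Sto aCNT vk (aCNT@[vk] + #1);;
    If (aDEG@[vs * vn + vr0] - aCNT@[vk]) Skip (
      vf ::= aHEAD@[vs * vn + vc];;
      cop_loop);;
    ve ::= aNEXT@[ve]))%P.

Definition main_loop : cmd := (
  While (vtl - vhd) (
    vx ::= aQU@[vhd];;
    vhd ::= vhd + #1;;
    vi ::= vx %/ vn;;
    vr ::= vx - vi * vn;;
    vu ::= vi %/ vn;;
    vc ::= vi - vu * vn;;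
    vi ::= vu + vp - #1;;
    vs ::= vi - vi %/ vp * vp;;
    ve ::= aHEAD@[vs * vn + vr];;
    robber_loop))%P.

(** The code of (0, c, r) is [c * n + r], and a product of marks is their conjunction. *)
Definition scan_row : cmd := (
  While (vn - vr) (
    vk ::= vk * aMARK@[vc * vn + vr];;
    vr ::= vr + #1))%P.

Definition scan_loop : cmd := (
  While (vn - vc) (
    vk ::= #1;;
    vr ::= #0;;
    scan_row;;
    If vk (vout ::= #1) Skip;;
    vc ::= vc + #1))%P.

(** [n] is read and tested before [p]: when n = 0 there are no edges while p is arbitrary, so
    loading p could exceed the word bound. *)
Definition copwin_cmd : cmd := (
  vn ::= EIn #1;;
  If vn (
    vp ::= EIn #0;;
    vm ::= EIn #2;;
    build_loop;;
    vtl ::= vm;;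
    main_loop;;
    vc ::= #0;;
    vout ::= #0;;
    scan_loop) Skip)%P.

Ltac asg := apply: wp_seq; apply: wp_asg; [by []| |].
Ltac sto := apply: wp_seq; apply: wp_sto; [by []| | |].
Ltac cmp := rewrite /= /upd /=.

Ltac arith :=
  repeat match goal with
  | H : ?P |- _ =>
    lazymatch P with
    | is_true (leq _ _) => fail
    | @eq nat _ _ => fail
    | ~ _ => fail
    | is_true (~~ _) => fail
    | _ => clear H
    end
  end; lia.

(** * Verification of the loops *)

Section Program.
Variables (p n : nat) (E : nat -> rel 'I_n) (l : seq (nat * 'I_n * 'I_n)).
Hypotheses (p_gt0 : 0 < p) (n_gt0 : 0 < n) (hE : sinkless p E) (hl : edge_list p E l).
Variables (inp : seq nat) (X : nat).
Hypothesis size_inp : size inp = 3 * size l + 3.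
Hypothesis nth_inp : forall x0 j, j < size l ->
  [/\ nth 0 inp (3 * j + 3) = (nth x0 l j).1.1,
      nth 0 inp (3 * j + 4) = (nth x0 l j).1.2 &
      nth 0 inp (3 * j + 5) = (nth x0 l j).2].
Hypothesis hX : p * n * n + p * n + n + 3 * size l + 3 * p + 10 < X.

Implicit Types (q d : seq (nat * 'I_n * 'I_n)) (A B : seq ((nat * 'I_n * 'I_n) * 'I_n)).
Implicit Types (s : store) (e f x : nat * 'I_n * 'I_n).

(** The edge at index j has its tail in cell 3 j + 4, which is 3 (j + 1) + 1 for edge number j +
    1. *)
Lemma input_tail e : e \in l -> nth 0 inp (3 * (index e l).+1 + 1) = e.1.2.
Proof.
move=> el; have [|_ H _] := nth_inp e (j := index e l); first by rewrite index_mem.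
by rewrite nth_index // in H; rewrite -H; congr nth; arith.
Qed.

Record static s : Prop := Static {
  st_n : var s vn = n;
  st_p : var s vp = p;
  st_chain : forall i (v : 'I_n), i < p ->
    chain l (arr s aNEXT) (arr s aHEAD (i * n + v)) (in_edges i v l);
  st_deg : forall i (u : 'I_n), i < p -> arr s aDEG (i * n + u) = degree l i u }.

Record dyn s q A : Prop := Dyn {
  dy_tl : var s vtl = size q;
  dy_queue : forall j, j < size q -> arr s aQU j = nth 0 (map (@code n) q) j;
  dy_mark : forall x, x.1.1 < p -> arr s aMARK (code x) = (x \in q);
  dy_count : forall i c r, i < p -> arr s aCNT (code (i, c, r)) = counter l A i c r }.

(* [q] lists the marked states and [d] the processed ones; [A] lists the pairs (robber
   edge, cop vertex) and [B] the pairs (cop edge, robber vertex) visited so far. *)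
Record inv d q A B s : Prop := Inv {
  inv_static : static s;
  inv_dyn : dyn s q A;
  inv_hd : var s vhd = size d;
  inv_uniq : uniq q;
  inv_sound : sound p E q;
  inv_edges : {subset l <= q};
  inv_prefix : exists rest, q = d ++ rest;
  inv_uniqA : uniq A;
  inv_uniqB : uniq B;
  inv_Al : forall a, a \in A -> a.1 \in l;
  inv_Bl : forall b, b \in B -> b.1 \in l;
  inv_Bq : forall f r, (f, r) \in B -> (f.1.1, f.1.2, r) \in q }.

Lemma inv_ext d q A B s s' :
  inv d q A B s -> arr s' = arr s -> var s' vn = var s vn -> var s' vp = var s vp ->
  var s' vtl = var s vtl -> var s' vhd = var s vhd -> inv d q A B s'.
Proof.
move=> [[S1 S2 S3 S4] [D1 D2 D3 D4] H3 H4 H5 H6 H7 H8 H9 H10 H11 H12] Ea En Ep Et Eh.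
by split; rewrite ?Eh //; split; rewrite ?Ea ?En ?Ep ?Et.
Qed.

Definition bound := size l + p * n * n + 2 * (size l * n).

Lemma inv_bound d q A B s : inv d q A B s ->
  size d <= size q <= p * n * n /\ size l + size d + size A + size B <= bound.
Proof.
move=> I; have sq : size q <= p * n * n.
  by apply: size_states (inv_uniq I) _ => x /(inv_sound I)[].
have sA : size A <= size l * n := size_pairs (inv_uniqA I) (inv_Al I).
have sB : size B <= size l * n := size_pairs (inv_uniqB I) (inv_Bl I).
have [rest Eq] := inv_prefix I.
have sd : size d <= size q by rewrite Eq size_cat leq_addr.
by rewrite sq sd /bound; split=> //; arith.
Qed.

Lemma inv_count d q A B s e c i r k v :
  inv d q A B s -> e \in l -> e.1 = (i, r) -> (e, c) \notin A -> k = code (i, c, r) ->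
  v = (counter l A i c r).+1 -> inv d q ((e, c) :: A) B (seta s aCNT k v).
Proof.
move=> [[S1 S2 S3 S4] [D1 D2 D3 D4] H3 H4 H5 H6 H7 H8 H9 H10 H11 H12] el e1 eA -> ->.
split=> //=; last 2 first.
- by rewrite eA.
- by move=> a; rewrite inE => /orP[/eqP->|/H10].
split=> //= i' c' r' ip.
rewrite (counter_cons hl) // e1 /= /upd; case: eqP => [/code_inj[-> -> ->]|N].
  by rewrite eqxx addn1.
rewrite D4 //; case: eqP => [Ex|]; last by rewrite addn0.
by case: N; rewrite -Ex.
Qed.

Lemma inv_visit d q A B s f r :
  inv d q A B s -> f \in l -> (f, r) \notin B -> (f.1.1, f.1.2, r) \in q ->
  inv d q A ((f, r) :: B) s.
Proof.
move=> [H1 H2 H3 H4 H5 H6 H7 H8 H9 H10 H11 H12] fl fB fq; split=> //=.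
- by rewrite fB.
- by move=> a; rewrite inE => /orP[/eqP->|/H11].
- by move=> f' r'; rewrite inE => /orP[/eqP[-> ->]|/H12].
Qed.

Lemma inv_push d q A B s x k j :
  inv d q A B s -> x \notin q -> sound p E (rcons q x) -> k = code x -> j = size q ->
  inv d (rcons q x) A B (setv (seta (seta s aMARK k 1) aQU j k) vtl (j + 1)).
Proof.
move=> [[S1 S2 S3 S4] [D1 D2 D3 D4] H3 H4 H5 H6 [rest Eq] H8 H9 H10 H11 H12] xq sq -> ->.
split=> //=.
- split=> //=; first by rewrite size_rcons /upd /= addn1.
  + move=> j'; rewrite size_rcons map_rcons nth_rcons size_map ltnS /upd => Hj.
    by case: eqP => [->|/eqP N]; [rewrite ltnn|rewrite D2 ?ifT //; arith].
  + move=> y yp; rewrite mem_rcons inE /upd; case: eqP => [/code_inj ->|N].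
      by rewrite eqxx.
    by rewrite D3 //; case: eqP => // yx; case: N; rewrite yx.
- by rewrite rcons_uniq xq.
- by move=> e /H6; rewrite mem_rcons inE orbC => ->.
- by exists (rcons rest x); rewrite Eq rcons_cat.
- by move=> f r /H12; rewrite mem_rcons inE orbC => ->.
Qed.

Lemma inv_pop d q A B s x rest :
  inv d q A B s -> q = rcons d x ++ rest -> inv (rcons d x) q A B (setv s vhd (size d).+1).
Proof.
move=> [[S1 S2 S3 S4] [D1 D2 D3 D4] H3 H4 H5 H6 H7 H8 H9 H10 H11 H12] Eq.
by split=> //; [rewrite /= size_rcons|exists rest].
Qed.

(** A visit affects [full] at a single triple, where by [full_fresh] it was false before. Hence each
    triple becomes full once, and [cop_loop] runs once for it. *)
Lemma full_cons A e c i r i' c' r' : e.1 = (i, r) -> (i', c', r') != (i, c, r) ->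
  full l ((e, c) :: A) i' c' r' = full l A i' c' r'.
Proof.
move=> e1 N; apply: eq_all => e'; case: eqP => //= e1'.
rewrite inE; case: eqP => // -[Ee Ec]; case/eqP: N.
by move: e1'; rewrite Ee e1 => -[-> ->]; rewrite Ec.
Qed.

Lemma full_fresh A e c i r : e \in l -> e.1 = (i, r) -> (e, c) \notin A ->
  full l A i c r = false.
Proof.
move=> el e1 eA; apply/negbTE/negP => /allP /(_ e el).
by rewrite e1 eqxx (negbTE eA).
Qed.

(** On entry [B] is still described by [A0], without the visit [(e, c)] that has just filled the
    counter; the loop brings [B] up to date with [(e, c) :: A0]. *)
Lemma wp_cop_loop d q A0 B i (c r : 'I_n) e s (Q : store -> Prop) :
  i < p -> e \in l -> e.1 = (i, r) -> (e, c) \notin A0 ->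
  full l ((e, c) :: A0) i c r ->
  (forall e' c', (e', c') \in (e, c) :: A0 -> (e'.1.1.+1 %% p, c', e'.2) \in q) ->
  inv d q ((e, c) :: A0) B s ->
  var s vs = i -> var s vc = c -> var s vr0 = r -> var s ve = (index e l).+1 ->
  var s vf = arr s aHEAD (i * n + c) ->
  (forall f r', ((f, r') \in B) = (f \in l) && full l A0 f.1.1 f.2 r') ->
  ticks s <= size l + size d + (size A0).+1 + size B ->
  (forall s' q' B', inv d q' ((e, c) :: A0) B' s' -> {subset q <= q'} ->
     var s' vs = i -> var s' vc = c -> var s' ve = (index e l).+1 ->
     (forall f r', ((f, r') \in B') = (f \in l) && full l ((e, c) :: A0) f.1.1 f.2 r') ->
     ticks s' <= size l + size d + (size A0).+1 + size B' -> Q s') ->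
  wp inp X cop_loop Q s.
Proof.
move=> ip el e1 eA Hfull HA I Hs Hc Hr0 He Hf HB Ht HQ.
set A := (e, c) :: A0 in Hfull HA I HQ *.
pose LI s := exists q' B' done rest,
  [/\ inv d q' A B' s, {subset q <= q'},
    [/\ var s vs = i, var s vc = c, var s vr0 = r & var s ve = (index e l).+1],
    chain l (arr s aNEXT) (var s vf) rest /\ done ++ rest = in_edges i c l &
    (forall f r', ((f, r') \in B') =
       (f \in l) && full l A0 f.1.1 f.2 r' || (r' == r) && (f \in done)) /\
    ticks s <= size l + size d + (size A0).+1 + size B'].
apply: (wp_while (bnd := bound) (I := LI)); last 1 first.
- exists q, B, [::], (in_edges i c l); split=> //.
    by rewrite Hf; split=> //; exact: st_chain (inv_static I) _ _ ip.
  by split=> // f r'; rewrite HB in_nil andbF orbF.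
- move=> s1 [q1 [B1 [dn [rest [I1 _ _ _ [_ T1]]]]]].
  by have [_] := inv_bound I1; rewrite /=; arith.
- by [].
- move=> s1 [q1 [B1 [dn [rest [I1 sub1 [V1 V2 V3 V4] [C1 Ed] [HB1 T1]]]]]] /=.
  case: rest C1 Ed => [->//|f rest /= [Vf C1] Ed _]; rewrite Vf in C1.
  have : f \in in_edges i c l by rewrite -Ed mem_cat mem_head orbT.
  rewrite mem_in_edges => /and3P[/eqP fi /eqP fc fl].
  have fdn : f \notin dn.
    have := in_edges_uniq hl i c; rewrite -Ed cat_uniq => /and3P[_ /hasPn H _].
    by apply: H; rewrite mem_head.
  have [[V5 V6 SC SD] [D1 D2 D3 D4]] := (inv_static I1, inv_dyn I1).
  have Vc0 := input_tail fl.
  have fil : index f l < size l by rewrite index_mem.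
  have Bd := index_lt f.1.2 ip.
  have Bk : code (i, f.1.2, r) < p * n * n by exact: code_lt.
  have [/andP[_ Bq] _] := inv_bound I1.
  (* The triple was not full under [A0] and [f] is not yet done, so the pair is new and its addition
     to [B] pays for the pass. *)
  have fB : (f, r) \notin B1.
    by rewrite HB1 negb_or fi fc (full_fresh el e1 eA) andbF (negbTE fdn) andbF.
  have un := ltn_ord f.1.2.
  asg.
    by cmp; rewrite Vf Vc0 size_inp; split; repeat split; arith.
  cmp; rewrite Vf Vc0; asg.
    rewrite /code /= in Bk.
    by cmp; rewrite V1 V3 V5; repeat split; arith.
  cmp; rewrite V1 V3 V5 -[_ + r]/(code (i, f.1.2, r)); set k := code _ in Bk *.
  set s2 := setv _ vk k.
  have I2 : inv d q1 A B1 s2 by apply: (inv_ext I1).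
  have Emark : arr s2 aMARK k = ((i, f.1.2, r) \in q1) by exact: D3.
  apply: wp_seq; apply: wp_if => /=; rewrite ?Emark.
  + by [].
  + rewrite eqb0 negbK => inq; apply: wp_skip; apply: wp_asg => //.
    exists q1, ((f, r) :: B1), (rcons dn f), rest; split=> //.
    * apply: (inv_ext (s := s2)) => //; apply: inv_visit => //.
      by rewrite fi.
    * by split; [rewrite /= /upd /= Vf|rewrite cat_rcons].
    * split; last by rewrite /=; arith.
      move=> f' r'; rewrite inE xpair_eqE HB1 mem_rcons inE.
      by case: (f' == f); case: (r' == r); rewrite ?orbT ?orbF //.
  move/eqP; rewrite eqb0 => ninq.
  sto; [by []|by rewrite /=; arith|].
  sto; [by []|by []|].
  apply: wp_asg => //.
    by cmp; rewrite D1; repeat split; arith.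
  cmp; rewrite D1.
  apply: wp_asg => //; set s3 := setv _ vtl _.
  have I3 : inv d (rcons q1 (i, f.1.2, r)) A ((f, r) :: B1) s3.
    apply: inv_visit => //; last by rewrite fi mem_rcons mem_head.
    apply: inv_push => //.
    (* Fullness places every reply from [r] in [A], and [HA] places the resulting states in the
       queue: exactly the premise of soundness. *)
    rewrite -fi; apply: (sound_rcons hl (inv_sound I1) fl) => e' el'.
    rewrite fi fc => e1'; apply: sub1; have := allP Hfull _ el'.
    by rewrite e1' eqxx /= => /HA; rewrite e1'.
  exists (rcons q1 (i, f.1.2, r)), ((f, r) :: B1), (rcons dn f), rest; split=> //.
  + by apply: (inv_ext I3).
  + by move=> y /sub1; rewrite mem_rcons inE orbC => ->.
  + by split; [rewrite /= /upd /= Vf|rewrite cat_rcons].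
  + split; last by rewrite /=; arith.
    move=> f' r'; rewrite inE xpair_eqE HB1 mem_rcons inE.
    by case: (f' == f); case: (r' == r); rewrite ?orbT ?orbF //.
move=> s1 [q1 [B1 [dn [rest [I1 sub1 [V1 V2 V3 V4] [C1 Ed] [HB1 T1]]]]]] /= Vf.
case: rest C1 Ed => [_|f rest /= [Vf' _]]; last by rewrite Vf' in Vf.
rewrite cats0 => Ed; apply: (HQ s1 q1 B1) => // f r'; rewrite HB1 Ed mem_in_edges.
case: (boolP (f \in l)) => fl; last by rewrite !andbF.
case: (eqVneq (f.1.1, f.2, r') (i, c, r)) => [[-> -> ->]|N].
  by rewrite !eqxx Hfull orbT.
rewrite (full_cons A0 e1 N) /=; case: (full _ _ _ _ _) => //=.
apply/negbTE/negP => /and4P[/eqP Er /eqP Ei /eqP Ec _]; case/eqP: N.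
by rewrite Er Ei Ec.
Qed.

Lemma counter_le A i c r : counter l A i c r <= degree l i r.
Proof. by apply: sub_count => e /andP[]. Qed.

Lemma degree_le i r : degree l i r <= size l.
Proof. exact: count_size. Qed.

(** The analogue one level up: [A] is described by the processed states, and the loop extends this
    description from [d] to [rcons d (t, c, r)]. The extra successor on [size d] is the tick of the
    enclosing pass. *)
Lemma wp_robber_loop d q A0 B i t (c r : 'I_n) s (Q : store -> Prop) :
  t < p -> i = (t + p - 1) %% p -> (t, c, r) \notin d ->
  inv (rcons d (t, c, r)) q A0 B s ->
  var s vs = i -> var s vc = c -> var s ve = arr s aHEAD (i * n + r) ->
  (forall e c', ((e, c') \in A0) = (e \in l) && ((e.1.1.+1 %% p, c', e.2) \in d)) ->
  (forall f r', ((f, r') \in B) = (f \in l) && full l A0 f.1.1 f.2 r') ->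
  ticks s <= size l + (size d).+1 + size A0 + size B ->
  (forall s' q' A' B', inv (rcons d (t, c, r)) q' A' B' s' ->
     (forall e c', ((e, c') \in A') =
        (e \in l) && ((e.1.1.+1 %% p, c', e.2) \in rcons d (t, c, r))) ->
     (forall f r', ((f, r') \in B') = (f \in l) && full l A' f.1.1 f.2 r') ->
     ticks s' <= size l + (size d).+1 + size A' + size B' -> Q s') ->
  wp inp X robber_loop Q s.
Proof.
move=> tp Ei xd I Hs Hc He HA HB Ht HQ.
have ip : i < p by rewrite Ei ltn_mod.
have Eit : i.+1 %% p = t by apply/eqP; rewrite modn_succ_pred // Ei.
pose LI s := exists q' A' B' done rest,
  [/\ inv (rcons d (t, c, r)) q' A' B' s, var s vs = i /\ var s vc = c,
    chain l (arr s aNEXT) (var s ve) rest /\ done ++ rest = in_edges i r l,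
    (forall e c', ((e, c') \in A') =
      (e \in l) && ((e.1.1.+1 %% p, c', e.2) \in d) || (c' == c) && (e \in done)) &
    (forall f r', ((f, r') \in B') = (f \in l) && full l A' f.1.1 f.2 r') /\
    ticks s <= size l + (size d).+1 + size A' + size B'].
apply: (wp_while (bnd := bound) (I := LI)); last 1 first.
- exists q, A0, B, [::], (in_edges i r l); split=> //.
    by rewrite He; split=> //; exact: st_chain (inv_static I) _ _ ip.
  by move=> e c'; rewrite HA in_nil andbF orbF.
- move=> s1 [q1 [A1 [B1 [dn [rest [I1 _ _ _ [_ T1]]]]]]].
  by have [_] := inv_bound I1; rewrite size_rcons; arith.
- by [].
- move=> s1 [q1 [A1 [B1 [dn [rest [I1 [V1 V2] [C1 Ed] HA1 [HB1 T1]]]]]]] /=.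
  case: rest C1 Ed => [->//|e rest /= [Ve _] Ed _].
  have : e \in in_edges i r l by rewrite -Ed mem_cat mem_head orbT.
  rewrite mem_in_edges => /and3P[/eqP ei /eqP er el].
  have edn : e \notin dn.
    have := in_edges_uniq hl i r; rewrite -Ed cat_uniq => /and3P[_ /hasPn H _].
    by apply: H; rewrite mem_head.
  have [[V5 V6 SC SD] [D1 D2 D3 D4]] := (inv_static I1, inv_dyn I1).
  have Vr0 := input_tail el.
  have eil : index e l < size l by rewrite index_mem.
  have Bd := index_lt c ip; have Bd' := index_lt e.1.2 ip.
  have Bk : code (i, c, e.1.2) < p * n * n by exact: code_lt.
  have dq1 : {subset rcons d (t, c, r) <= q1}.
    by have [tl ->] := inv_prefix I1; move=> y yd; rewrite mem_cat yd.
  have xq1 : (t, c, r) \in q1 by apply: dq1; rewrite mem_rcons mem_head.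
  (* An earlier visit of this pair would require that [(t, c, r)] was processed before, or that [e]
     is done. *)
  have eA : (e, c) \notin A1.
    by rewrite HA1 ei er Eit (negbTE xd) (negbTE edn) !andbF.
  have e1 : e.1 = (i, e.1.2) by rewrite -ei -surjective_pairing.
  have un := ltn_ord e.1.2.
  have CL := counter_le A1 i c e.1.2; have DL := degree_le i e.1.2.
  asg.
    by cmp; rewrite Ve Vr0 size_inp; split; repeat split; arith.
  cmp; rewrite Ve Vr0; asg.
    rewrite /code /= in Bk.
    by cmp; rewrite V1 V2 V5; repeat split; arith.
  cmp; rewrite V1 V2 V5 -[_ + e.1.2]/(code (i, c, e.1.2)); set k := code _ in Bk *.
  have Ek : arr s1 aCNT k = counter l A1 i c e.1.2 by exact: D4.
  sto; [by []| |].
    by cmp; rewrite Ek; repeat split; arith.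
  cmp; rewrite Ek; set s2 := seta _ _ _ _.
  have I2 : inv (rcons d (t, c, r)) q1 ((e, c) :: A1) B1 s2.
    by apply: inv_count el e1 eA _ _; rewrite ?addn1 //; apply: (inv_ext I1).
  have [[_ _ SC2 SD2] [_ _ _ D42]] := (inv_static I2, inv_dyn I2).
  have Edeg : arr s2 aDEG (i * n + e.1.2) = degree l i e.1.2 by exact: SD2.
  have Ecnt : arr s2 aCNT k = counter l ((e, c) :: A1) i c e.1.2 by exact: D42.
  have CL2 := counter_le ((e, c) :: A1) i c e.1.2.
  have HA2 q2 : {subset q1 <= q2} -> forall e' c', (e', c') \in (e, c) :: A1 ->
      (e'.1.1.+1 %% p, c', e'.2) \in q2.
    move=> sub e' c'; rewrite inE HA1 => /or3P[/eqP[-> ->]|/andP[_ H]|/andP[/eqP-> H]];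
      apply: sub.
    + by rewrite ei er Eit.
    + by apply: dq1; rewrite mem_rcons inE H orbT.
    + have : e' \in in_edges i r l by rewrite -Ed mem_cat H.
      by rewrite mem_in_edges => /and3P[/eqP-> /eqP-> _]; rewrite Eit.
  have Hstep s3 q3 B3 : inv (rcons d (t, c, r)) q3 ((e, c) :: A1) B3 s3 ->
      var s3 vs = i -> var s3 vc = c -> var s3 ve = (index e l).+1 ->
      (forall f r', ((f, r') \in B3) = (f \in l) && full l ((e, c) :: A1) f.1.1 f.2 r') ->
      ticks s3 <= size l + (size d).+1 + (size A1).+1 + size B3 ->
      wp inp X (ve ::= aNEXT@[ve])%P LI s3.
    move=> I3 W1 W2 W3 HB3 T3; apply: wp_asg => //; rewrite /= W3.
    (* The state may come out of [cop_loop], so the position in the list is recovered from the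
       static lists and [ve]. *)
    have := st_chain (inv_static I3) r ip; rewrite -Ed => /chain_cat C3.
    exists q3, ((e, c) :: A1), B3, (rcons dn e), rest; split=> //.
    + exact: (inv_ext I3).
    + by split; [|rewrite cat_rcons].
    + move=> e' c'; rewrite inE xpair_eqE HA1 mem_rcons inE.
      by case: (e' == e); case: (c' == c); rewrite ?orbT ?orbF.
  apply: wp_seq; apply: wp_if.
  + by cmp; rewrite V1 V5; repeat split; arith.
  + move=> Nz; apply: wp_skip; apply: (Hstep s2 q1 B1) => //; last by rewrite /=; arith.
    have Nfull : full l ((e, c) :: A1) i c e.1.2 = false.
      apply/negbTE; rewrite -counter_full; apply: contraNneq Nz => Ecd.
      move: Edeg Ecnt; rewrite /= /upd /= V1 V5 => -> ->; rewrite Ecd; arith.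
    move=> f r'; rewrite HB1; congr (_ && _).
    case: (eqVneq (f.1.1, f.2, r') (i, c, e.1.2)) => [[-> -> ->]|N].
      by rewrite Nfull (full_fresh el e1 eA).
    by rewrite (full_cons A1 e1 N).
  move=> Ze; have Hfull : full l ((e, c) :: A1) i c e.1.2.
    rewrite -counter_full; apply/eqP; move: Ze Edeg Ecnt.
    by rewrite /= /upd /= V1 V5 => + Edeg Ecnt; rewrite Edeg Ecnt; arith.
  apply: wp_seq; apply: wp_asg => //; first by cmp; rewrite V1 V2 V5; repeat split; arith.
  cmp; rewrite V1 V2 V5.
  set s3 := setv _ vf _.
  have I3 : inv (rcons d (t, c, r)) q1 ((e, c) :: A1) B1 s3 by apply: (inv_ext I2).
  apply: (wp_cop_loop ip el e1 eA Hfull (HA2 _ (fun _ => id)) I3) => //.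
    by rewrite size_rcons /=; arith.
  move=> s4 q4 B4 I4 sub4 W1 W2 W3 HB4 T4.
  apply: (Hstep s4 q4 B4) => //; rewrite size_rcons in T4; exact: T4.
move=> s1 [q1 [A1 [B1 [dn [rest [I1 [V1 V2] [C1 Ed] HA1 [HB1 T1]]]]]]] /= Ve.
case: rest C1 Ed => [_|f rest /= [Ve' _]]; last by rewrite Ve' in Ve.
rewrite cats0 => Ed; apply: (HQ s1 q1 A1 B1) => // e c'.
rewrite HA1 Ed mem_in_edges mem_rcons inE !xpair_eqE.
case: (boolP (e \in l)) => el; last by rewrite !andbF.
rewrite /= !andbT modn_succ_pred ?(edge_time hl) // -Ei orbC.
by case: (e.1.1 == i); case: (c' == c); case: (e.2 == r).
Qed.

Lemma wp_main_loop s (Q : store -> Prop) :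
  inv [::] l [::] [::] s -> ticks s <= size l ->
  (forall s' q, static s' -> (forall x, x.1.1 < p -> arr s' aMARK (code x) = (x \in q)) ->
     (copwin p E <-> exists c, forall r, (0, c, r) \in q) ->
     ticks s' <= bound -> Q s') ->
  wp inp X main_loop Q s.
Proof.
move=> I Ht HQ.
pose LI s := exists d q A B,
  [/\ inv d q A B s,
    (forall e c', ((e, c') \in A) = (e \in l) && ((e.1.1.+1 %% p, c', e.2) \in d)),
    (forall f r', ((f, r') \in B) = (f \in l) && full l A f.1.1 f.2 r') &
    ticks s <= size l + size d + size A + size B].
apply: (wp_while (bnd := bound) (I := LI)); last 1 first.
- exists [::], l, [::], [::]; split=> //.
  + by move=> e c'; rewrite in_nil andbF.
  + move=> f r'; rewrite in_nil; case: (boolP (f \in l)) => //= fl.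
    by rewrite (not_full hE hl (edge_time hl fl)).
  + by rewrite /= !addn0.
- by move=> s1 [d [q [A [B [I1 _ _ T1]]]]]; have [_] := inv_bound I1; arith.
- by [].
- move=> s1 [d [q [A [B [I1 HA HB T1]]]]] /=.
  have [[V5 V6 SC SD] [D1 D2 D3 D4]] := (inv_static I1, inv_dyn I1).
  rewrite (inv_hd I1) D1 => Hlt.
  have [rest Eq] := inv_prefix I1.
  case: rest Eq => [Eq|x rest Eq]; first by move: Hlt; rewrite Eq cats0 subnn.
  have xq : x \in q by rewrite Eq mem_cat mem_head orbT.
  have tp : x.1.1 < p by have [] := inv_sound I1 xq.
  have [/andP[Bd Bq] _] := inv_bound I1.
  have sdq : size d < size q by rewrite Eq size_cat /=; arith.
  have xd : x \notin d.
    have := inv_uniq I1; rewrite Eq cat_uniq => /and3P[_ /hasPn H _].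
    by apply: H; rewrite mem_head.
  have Vq : arr s1 aQU (size d) = code x.
    by rewrite D2 // Eq map_cat nth_cat size_map ltnn subnn.
  have Bx := code_lt tp; have By := index_lt x.1.2 tp.
  have D_y : code x %/ n = x.1.1 * n + x.1.2.
    by rewrite /code divnMDl // divn_small ?addn0.
  have D_t : (x.1.1 * n + x.1.2) %/ n = x.1.1.
    by rewrite divnMDl // divn_small ?addn0.
  set w := x.1.1 + p - 1.
  have Ew : w - w %/ p * p = w %% p by rewrite {1}(divn_eq w p) addKn.
  have wp_le : w %/ p * p <= w by exact: leq_divM.
  have ip : w %% p < p by rewrite ltn_mod.
  have Bw := index_lt x.2 ip.
  have wX : x.1.1 + p < X by arith.
  asg; first by cmp.
  cmp; rewrite (inv_hd I1) Vq.
  asg; first by cmp; rewrite (inv_hd I1); repeat split; arith.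
  cmp; rewrite (inv_hd I1).
  asg; first by cmp.
  cmp; rewrite V5 D_y.
  asg; first by cmp; rewrite V5; repeat split; move: Bx; rewrite /code; arith.
  cmp; rewrite V5 {2}/code addKn.
  asg; first by cmp.
  cmp; rewrite V5 D_t.
  asg; first by cmp; rewrite V5; repeat split; arith.
  cmp; rewrite V5 addKn.
  asg; first by cmp; rewrite V6; repeat split; arith.
  cmp; rewrite V6 -/w.
  asg; first by cmp; rewrite V6; repeat split; rewrite /w in wp_le *; arith.
  cmp; rewrite V6 Ew.
  asg; first by cmp; rewrite V5; repeat split; arith.
  cmp; rewrite V5.
  set s2 := setv _ ve _.
  have I2 : inv (rcons d x) q A B s2.
    apply: (inv_ext (s := setv s1 vhd (size d).+1)) => //; last first.
      by cmp; rewrite addn1.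
    by apply: (@inv_pop _ _ _ _ _ _ rest I1); rewrite cat_rcons.
  have Ex : x = (x.1.1, x.1.2, x.2) by rewrite -!surjective_pairing.
  rewrite Ex in I2 xd.
  apply: (wp_robber_loop tp (erefl (w %% p)) xd I2) => //; first by rewrite /=; arith.
  move=> s3 q3 A3 B3 I3 HA3 HB3 T3; exists (rcons d (x.1.1, x.1.2, x.2)), q3, A3, B3.
  by split=> //; rewrite size_rcons.
move=> s1 [d [q [A [B [I1 HA HB T1]]]]] /=.
rewrite (inv_hd I1) (dy_tl (inv_dyn I1)) => Hsub.
have Edq : d = q.
  have [rest Eq] := inv_prefix I1; move: Hsub; rewrite Eq size_cat.
  by case: rest {Eq} => [|y rest]; rewrite ?cats0 //= ; arith.
subst d; apply: (HQ s1 q) => //.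
- exact: inv_static I1.
- exact: dy_mark (inv_dyn I1).
(* With every queued state processed, replies leading into [q] lie in [A]; the triple is therefore
   full, the pair is in [B], and [inv_Bq] yields closure. *)
- apply: (copwin_closed p_gt0 hE hl (inv_sound I1) (inv_edges I1)) => f r fl Hf.
  apply: (inv_Bq I1); rewrite HB fl /=; apply/allP => e el; apply/implyP => /eqP e1.
  by rewrite HA el /= e1 Hf.
- by have [_] := inv_bound I1; arith.
Qed.

Lemma wp_build_loop s (Q : store -> Prop) :
  var s vn = n -> var s vp = p -> var s vm = size l -> var s ve = 0 -> var s vhd = 0 ->
  ticks s = 0 -> (forall a i, arr s a i = 0) ->
  (forall s', static s' -> dyn (setv s' vtl (size l)) l [::] -> var s' vm = size l ->
     var s' vhd = 0 -> ticks s' <= size l -> Q s') ->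
  wp inp X build_loop Q s.
Proof.
move=> Hn Hp Hm He Hh Ht Ha HQ.
pose LI s := exists2 j, j <= size l &
  [/\ [/\ var s vn = n, var s vp = p, var s vm = size l, var s vhd = 0 & var s ve = j],
   ticks s = j,
   [/\ forall i (v : 'I_n), i < p ->
         chain l (arr s aNEXT) (arr s aHEAD (i * n + v)) (in_edges i v (take j l)) &
       forall i (u : 'I_n), i < p -> arr s aDEG (i * n + u) = degree (take j l) i u],
   [/\ forall i, i < j -> arr s aQU i = nth 0 (map (@code n) l) i &
       forall x, x.1.1 < p -> arr s aMARK (code x) = (x \in take j l)] &
   forall i, arr s aCNT i = 0].
apply: (wp_while (bnd := bound) (I := LI)); last 1 first.
- exists 0 => //; split=> //; rewrite take0.
  + by split=> *; rewrite Ha.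
  + by split=> *; rewrite Ha.
- by move=> s1 [j Hj [_ Tj _ _ _]]; rewrite Tj /bound; arith.
- by [].
- move=> s1 [j Hj [[V1 V2 V3 V9 V4] T1 [HC HD] [HU HM] HK]] /=.
  rewrite V3 V4 => Hlt; have {Hlt}jl : j < size l by arith.
  pose x0 : nat * 'I_n * 'I_n := (0, Ordinal n_gt0, Ordinal n_gt0).
  have [N1 N2 N3] := nth_inp x0 jl; set x := nth x0 l j in N1 N2 N3.
  have xl : x \in l by rewrite mem_nth.
  have tp : x.1.1 < p := edge_time hl xl.
  have Ex : take j.+1 l = rcons (take j l) x by rewrite (take_nth x0).
  (* Because the input has no duplicates, the loop counter agrees with the numbering of edges by
     [index]. *)
  have Ix : index x l = j by rewrite index_uniq //; exact: hl.1.
  have Bx := code_lt tp; have Bu := index_lt x.1.2 tp; have Bv := index_lt x.2 tp.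
  have un := ltn_ord x.1.2; have vn' := ltn_ord x.2.
  have Bpn := leq_pmulr p n_gt0.
  asg; first by cmp; rewrite V4 N1 size_inp; split; repeat split; arith.
  cmp; rewrite V4 N1.
  asg; first by cmp; rewrite V4 N2 size_inp; split; repeat split; arith.
  cmp; rewrite V4 N2.
  asg; first by cmp; rewrite V4 N3 size_inp; split; repeat split; arith.
  cmp; rewrite V4 N3.
  asg; first by cmp; rewrite V1; repeat split; move: Bx; rewrite /code; arith.
  cmp; rewrite V1 -[_ + x.2]/(code x).
  sto; [by []|by rewrite /=; arith|]; cmp.
  sto; [by []|by []|]; cmp; rewrite V4.
  asg; first by cmp; rewrite V4; repeat split; arith.
  cmp; rewrite V4 addn1.
  sto; [by []|by cmp; rewrite V1; repeat split; arith|].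
  cmp; rewrite V1.
  sto; [by cmp; rewrite V1; repeat split; arith|by []|].
  cmp; rewrite V1.
  have dl : degree (take j l) x.1.1 x.1.2 <= size l.
    by apply: leq_trans (count_size _ _) _; rewrite size_take jl ltnW.
  apply: wp_sto => //; first by cmp; rewrite V1; repeat split; arith.
    by cmp; rewrite V1 HD //; repeat split; arith.
  cmp; rewrite V1 HD //.
  exists j.+1 => //; split=> //.
  + by rewrite /= T1.
  + split=> [i v ip|i u ip]; rewrite Ex; cmp.
      rewrite /in_edges rev_rcons /=.
      (* Edges already listed have numbers at most [j], so the new cell [j.+1] lies outside every
         existing list. *)
      have Hnx : forall e, e \in in_edges i v (take j l) ->
          arr s1 aNEXT (index e l).+1 = upd (arr s1 aNEXT) j.+1
            (arr s1 aHEAD (x.1.1 * n + x.2)) (index e l).+1.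
        move=> e; rewrite mem_in_edges => /and3P[_ _ /index_ltn el].
        by rewrite /upd eqSS ifF //; apply/eqP; arith.
      case: eqP => [/index_inj[Ei Ev]|N].
        subst i v; rewrite !eqxx /= Ix /upd eqxx; split=> //.
        exact: eq_chain Hnx (HC _ _ tp).
      rewrite ifN; first exact: eq_chain Hnx (HC _ _ ip).
      by apply/negP => /andP[/eqP Ei /eqP Ev]; apply: N; rewrite Ei Ev.
    rewrite /degree -cats1 count_cat /= addn0; case: eqP => [/index_inj[-> ->]|N].
      by rewrite -surjective_pairing eqxx.
    rewrite HD // (_ : x.1 == (i, u) = false) ?addn0 //.
    by apply/eqP => Exi; apply: N; rewrite Exi.
  + split=> [i|y yp]; cmp.
      rewrite ltnS leq_eqVlt => /orP[/eqP ->|ij]; first by rewrite eqxx (nth_map x0).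
      by rewrite ifN ?HU //; apply/eqP => Eij; rewrite Eij ltnn in ij.
    rewrite Ex mem_rcons inE; case: eqP => [/code_inj ->|N]; first by rewrite eqxx.
    by rewrite HM //; case: eqP => // Eyx; case: N; rewrite Eyx.
move=> s1 [j Hj [[V1 V2 V3 V9 V4] T1 [HC HD] [HU HM] HK]] /=.
rewrite V3 V4 => Hsub; have Ej : j = size l by arith.
rewrite Ej take_size in HC HD HU HM; apply: (HQ s1) => //; last by rewrite T1.
split=> //= i c r ip; rewrite HK /counter (eq_count (a2 := pred0)) ?count_pred0 // => e.
by rewrite in_nil andbF.
Qed.

Lemma forall_ltnS (P : pred 'I_n) (i : 'I_n) :
  [forall j : 'I_n, (j < i.+1) ==> P j] = [forall j : 'I_n, (j < i) ==> P j] && P i.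
Proof.
apply/forallP/andP => [H|[/forallP H Pi] j].
  split; last by have := H i; rewrite leqnn.
  by apply/forallP => j; apply/implyP => ji; have := H j; rewrite ltnS ltnW.
rewrite ltnS leq_eqVlt; apply/implyP => /orP[/eqP/val_inj->//|ji].
by have := H j; rewrite ji.
Qed.

Lemma exists_ltnS (P : pred 'I_n) (i : 'I_n) :
  [exists j : 'I_n, (j < i.+1) && P j] = [exists j : 'I_n, (j < i) && P j] || P i.
Proof.
apply: negb_inj; rewrite negb_or !negb_exists.
under eq_forallb do rewrite negb_and -implybE.
rewrite forall_ltnS; congr (_ && _).
by apply: eq_forallb => j; rewrite negb_and -implybE.
Qed.

Lemma wp_scan_row s q T (c : 'I_n) (Q : store -> Prop) :
  var s vn = n -> var s vc = c -> var s vr = 0 -> var s vk = 1 ->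
  (forall c r : 'I_n, arr s aMARK (c * n + r) = ((0, c, r) \in q)) -> ticks s <= T ->
  (forall s', var s' vn = n -> var s' vc = c -> var s' vout = var s vout ->
     var s' vk = [forall r, (0, c, r) \in q] -> arr s' = arr s -> ticks s' <= T + n ->
     Q s') ->
  wp inp X scan_row Q s.
Proof.
move=> Hn Hc Hr Hk HM Ht HQ.
pose LI s1 := exists2 r, r <= n &
  [/\ [/\ var s1 vn = n, var s1 vc = c, var s1 vr = r & var s1 vout = var s vout],
    var s1 vk = [forall r' : 'I_n, (r' < r) ==> ((0, c, r') \in q)],
    arr s1 = arr s & ticks s1 <= T + r].
apply: (wp_while (bnd := T + n) (I := LI)); last 1 first.
- exists 0 => //; split=> //; last by rewrite addn0.
  by rewrite Hk (_ : [forall _, _]) //; apply/forallP.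
- by move=> s1 [r Hr1 [_ _ _ T1]]; arith.
- by [].
- move=> s1 [r Hr1 [[V1 V2 V3 V4] Vk Ea T1]] /=; rewrite V1 V3 => Hlt.
  have rn : r < n by arith.
  have Bc := index_lt (Ordinal rn) (ltn_ord c); rewrite /= in Bc.
  have En : n * n <= p * n * n by rewrite -mulnA leq_pmull.
  have Em : arr s1 aMARK (c * n + r) = ((0, c, Ordinal rn) \in q) by rewrite Ea -HM.
  asg.
    cmp; rewrite V1 V2 V3 Em Vk mulnb; split; last 1 first.
    + by case: (_ && _); arith.
    + by [].
    by repeat split; arith.
  apply: wp_asg => //; first by cmp; rewrite V3; repeat split; arith.
  exists r.+1 => //; cmp; rewrite V3 addn1 V1 V2 Em Vk mulnb.
  split=> //; last by arith.
  by rewrite (forall_ltnS _ (Ordinal rn)).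
move=> s1 [r Hr1 [[V1 V2 V3 V4] Vk Ea T1]] /=; rewrite V1 V3 => Hsub.
apply: HQ => //; last by arith.
rewrite Vk; congr nat_of_bool; apply: eq_forallb => r'.
by rewrite (_ : r' < r) // (leq_trans (ltn_ord r')) //; arith.
Qed.

Lemma wp_scan_loop s q T (Q : store -> Prop) :
  var s vn = n -> var s vc = 0 -> var s vout = 0 ->
  (forall c r : 'I_n, arr s aMARK (c * n + r) = ((0, c, r) \in q)) -> ticks s <= T ->
  (forall s', var s' vout = [exists c, [forall r, (0, c, r) \in q]] ->
     ticks s' <= T + n * n.+1 -> Q s') ->
  wp inp X scan_loop Q s.
Proof.
move=> Hn Hc Ho HM Ht HQ.
pose LI s1 := exists2 c, c <= n &
  [/\ [/\ var s1 vn = n, var s1 vc = c &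
       var s1 vout = [exists c' : 'I_n, (c' < c) && [forall r, (0, c', r) \in q]]],
    arr s1 = arr s & ticks s1 <= T + c * n.+1].
apply: (wp_while (bnd := T + n * n.+1) (I := LI)); last 1 first.
- exists 0 => //; split=> //; last by rewrite addn0.
  by split=> //; rewrite Ho; case: existsP => // -[].
- move=> s1 [c Hc1 [_ _ T1]]; apply: leq_trans T1 _.
  by rewrite leq_add2l leq_mul2r Hc1 orbT.
- by [].
- move=> s1 [c Hc1 [[V1 V2 V3] Ea T1]] /=; rewrite V1 V2 => Hlt.
  have cn : c < n by arith.
  asg; first by cmp; arith.
  asg; first by cmp; arith.
  apply: wp_seq; apply: (wp_scan_row (c := Ordinal cn) (q := q) (T := T + c * n.+1 + 1)) => //.
  + by move=> c' r'; rewrite -HM /= Ea.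
  + by rewrite /=; arith.
  move=> s2 W1 W2 W3 W4 W5 T2.
  have Hstep s3 : var s3 vn = n -> var s3 vc = c -> arr s3 = arr s ->
      ticks s3 = ticks s2 ->
      var s3 vout = [exists c' : 'I_n, (c' < c.+1) && [forall r, (0, c', r) \in q]] ->
      wp inp X (vc ::= vc + #1)%P LI s3.
    move=> U1 U2 U3 U4 U5; apply: wp_asg => //.
      by cmp; rewrite U2; repeat split; arith.
    exists c.+1 => //; cmp; rewrite U2 addn1; split=> //.
    by rewrite U4 mulSn; arith.
  apply: wp_seq; apply: wp_if => //=.
  + rewrite W4 eqb0 negbK => Hall; apply: wp_asg => //; first by cmp; arith.
    apply: Hstep; rewrite ?W5 //; cmp.
    by rewrite (exists_ltnS _ (Ordinal cn)) Hall orbT.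
  rewrite W4 => /eqP; rewrite eqb0 => Hall; apply: wp_skip; apply: Hstep; rewrite ?W5 //.
  by rewrite W3 /= /upd /= V3 (exists_ltnS _ (Ordinal cn)) (negbTE Hall) orbF.
move=> s1 [c Hc1 [[V1 V2 V3] Ea T1]] /=; rewrite V1 V2 => Hsub.
have Ec : c = n by arith.
rewrite Ec in T1 V3; apply: (HQ s1) => //.
by rewrite V3; congr nat_of_bool; apply: eq_existsb => c'; rewrite ltn_ord.
Qed.

Hypotheses (inp0 : nth 0 inp 0 = p) (inp1 : nth 0 inp 1 = n) (inp2 : nth 0 inp 2 = size l).

Lemma wp_copwin :
  wp inp X copwin_cmd (fun s => ticks s <= bound + n * n.+1 /\
    ((copwin p E -> var s vout = 1) /\ (~ copwin p E -> var s vout = 0))) start.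
Proof.
asg; first by rewrite /= size_inp inp1; repeat split; arith.
rewrite /= inp1; apply: wp_if => //= [_|]; last by cmp; arith.
asg; first by rewrite /= size_inp inp0; repeat split; arith.
asg; first by rewrite /= size_inp inp2; repeat split; arith.
rewrite /= inp0 inp2; apply: wp_seq.
apply: wp_build_loop => // s1 S1 D1 V3 V9 T1.
asg; first by [].
rewrite /= V3; apply: wp_seq; apply: wp_main_loop => //.
  split=> //.
  - by case: S1 => S2 S3 S4 S5; split.
  - exact: hl.1.
  - exact: sound_edges hl.
  - by exists l.
move=> s2 q S2 HM HC T2.
asg; first by rewrite /=; arith.
asg; first by rewrite /=; arith.
apply: (wp_scan_loop (q := q) (T := bound)) => //.
- exact: st_n S2.
- by move=> c r; rewrite -(HM (0, c, r)).
move=> s3 V T3; split=> //; rewrite V; split=> [/HC[c Hc]|Nc].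
  by rewrite (_ : [exists _, _]) //; apply/existsP; exists c; apply/forallP.
case: existsP => // -[c /forallP Hc]; case: Nc; apply/HC; by exists c.
Qed.

End Program.

(** * Word size and running time *)

Lemma halts_within_leq W prog inp T T' Q :
  T <= T' -> halts_within W prog inp T Q -> halts_within W prog inp T' Q.
Proof. by move=> TT' [j [c [jT H]]]; exists j, c; split=> //; exact: leq_trans TT'. Qed.

Theorem theorem5 :
  exists (prog : seq instr) (k C : nat),
    forall (p n : nat) (E : nat -> rel 'I_n) (l : seq (nat * 'I_n * 'I_n)),
      0 < p -> sinkless p E -> edge_list p E l ->
      halts_within ((size (encode p l)).+2 ^ k) prog (encode p l)
        (C * (p * n ^ 2 + n * size l) + C)
        (fun out => (copwin p E -> out = 1) /\ (~ copwin p E -> out = 0)).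
Proof.
set S := (size (ccmd 0 copwin_cmd)).+2.
exists (ccmd 0 copwin_cmd ++ output_code vout), 4, (3 * S) => p n E l p_gt0 hE hl.
have i0 : nth 0 (encode p l) 0 = p by [].
have i1 : nth 0 (encode p l) 1 = n by [].
have i2 : nth 0 (encode p l) 2 = size l by [].
move: (size_encode p l) (@nth_encode p n l) i0 i1 i2.
move: (encode p l) => inp size_inp nth_inp inp0 inp1 inp2.
(* Program values stay below N^2 because p n^2 <= m^2; the exponent 4 leaves room for the addresses,
   which reach about 6 N^2. *)
set N := (size inp).+2; set X := N * N.
have EN : N = 3 * size l + 5 by rewrite /N size_inp; lia.
have N_X : N <= X by rewrite /X EN; nia.
have X25 : 25 <= X by rewrite /X EN; nia.
have hW : num_arrs * X + num_arrs + size inp < N ^ 4.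
  have -> : N ^ 4 = X * X by rewrite /X (expnM N 2 2) -mulnn mulnn.
  have := leq_mul X25 (leqnn X); rewrite size_inp; lia.
have hX0 : 0 < X by lia.
have [n0|n_gt0] := posnP n.
  (* Without vertices there is no starting vertex for the cop, and [vout] keeps its initial value
     0. *)
  apply: halts_within_leq (wp_halts (T := 0) (out := vout) hW hX0 _ _); rewrite // -/S; first lia.
  asg; first by rewrite /= size_inp inp1; repeat split; lia.
  apply: wp_if => //; first by rewrite /= inp1 => /eqP.
  move=> _; apply: wp_skip; split=> //; split=> // -[c0 _].
  by have := ltn_ord c0; lia.
have pnl := size_edges_ge hE hl.
apply: halts_within_leq (wp_halts (T := bound p l + n * n.+1) (out := vout) hW hX0 _ _) => //.
  rewrite -/S; have Hn2 : n * n <= p * (n * n) by rewrite leq_pmull.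
  have Hn : n <= n * n by rewrite leq_pmull.
  have Hl : size l <= n * size l by rewrite leq_pmull.
  (* The constant 3 collects p n^2 + n^2 + n <= 3 p n^2 and m + 2 n m <= 3 n m. *)
  have HT : bound p l + n * n.+1 <= 3 * (p * n ^ 2 + n * size l).
    by rewrite /bound -mulnn; lia.
  have := leq_mul (leqnn S) HT; lia.
apply: (wp_copwin p_gt0 n_gt0 hE hl) => //.
have pp : p <= p * n by rewrite leq_pmulr.
have nn : n <= p * n by rewrite leq_pmull.
have pnn : p * n * n <= size l * size l by apply: leq_mul => //; lia.
by rewrite /X EN; nia.
Qed.
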